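(* Let $n\ge 1$, $\rho_0>0$, $\gamma>0$, $\mu>0$ and $\lambda+2\mu/3\ge 0$, and set $$c_1=\frac{4\pi^2\mu}{\rho_0},\qquad c_2=\frac{4\pi^2(\lambda+\mu)}{\rho_0},\qquad c_5=4\pi^2\gamma\rho_0^{\gamma-1}.$$ For kernels $\varphi_\rho,\varphi_u$ on $[0,1]^n$ (periodic), consider the error system for $r(t,x)\in\mathbb{R}$, $v(t,x)\in\mathbb{R}^n$, with periodic boundary conditions on $[0,1]^n$: $$r_t+\rho_0\nabla\cdot v=-\rho_0\,\varphi_\rho\ast(\nabla\cdot v),$$ $$\rho_0 v_t=\mu\Delta v+(\lambda+\mu)\nabla(\nabla\cdot v)-\gamma\rho_0^{\gamma-1}\nabla r-\rho_0\,\varphi_u\ast v .$$ Assume that the mean value of $r(t,\cdot)$ over $[0,1]^n$ is $0$. Then for any $d>0$ and any $K>0$ one can find $\varphi_\rho(x)$ and $\varphi_u(x)$ such that the maximal decay rate towards $0$ of the errors $r,v$, solutions of this system, is at least $d$ for every Fourier mode $k\in\mathbb{Z}^n$ with $|k|\le K$. Moreover, the kernels with the following Fourier coefficients can be chosen: $$\varphi_{u0}=d,\qquad \varphi_{\rho 0}=0;$$ for $0<|k|\le K$, $$\varphi_{uk}=\max\{0;\ d-c_1|k|^2;\ 2d-(c_1+c_2)|k|^2\},\qquad \varphi_{\rho k}=\max\left\{0;\ \frac{\left((c_1+c_2)|k|^2+\varphi_{uk}\right)^2}{4c_5|k|^2}-1\right\};$$ and $\varphi_{uk}=0$, $\varphi_{\rho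 k}=0$ for $|k|>K$.
   Context: The functions $r$ and $v$ are the errors (observer minus true state) in density and velocity for the compressible Navier-Stokes system linearized around a constant state with density $\rho_0$ and zero velocity; $\lambda,\mu$ are the Lamé parameters and $\gamma$ the adiabatic exponent. All functions are periodic with period $1$ in each coordinate, $\ast$ is (componentwise) periodic convolution in $x$ over $[0,1]^n$, and the kernels $\varphi_\rho,\varphi_u$ are time-independent, isotropic functions of $x$. Fourier expansions: $v(t,x)=\sum_{k\in\mathbb{Z}^n}a_k(t)e^{i2\pi k\cdot x}$, $r(t,x)=\sum_{k\in\mathbb{Z}^n}b_k(t)e^{i2\pi k\cdot x}$, with $a_k(t)$ a vector with $n$ components and $b_k(t)$ a scalar (complex-valued); $\varphi_{\rho k},\varphi_{uk}$ are the Fourier coefficients of $\varphi_\rho,\varphi_u$, so that the $k$-th Fourier coefficient of $\varphi\ast f$ is $\varphi_k f_k$. $|k|^2=\sum_j k_j^2$. Solutions are regular enough that the system is equivalent, mode by mode, to the linear ODE system satisfied by $y_k(t)=(b_k(t),a_k(t))$, namely $$b_k'=-\rho_0 i2\pi(1+\varphi_{\rho k})\,(k\cdot a_k),\qquad \rho_0 a_k'=-(4\pi^2\mu|k|^2+\rho_0\varphi_{uk})a_k-4\pi^2(\lambda+\mu)(k\cdot a_k)k-\gamma\rho_0^{\gamma-1}i2\pi\, b_k k,$$ where $k\cdot a_k=\sum_j k_j a_{jk}$. The zero-mean assumption on $r$ means $b_0\equiv 0$. A number $d_k>0$ is a decay rate of $y_k$ if there is a constant $c>0$ with $\|y_k(t)\|\le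 c\,e^{-d_kt}$ for all $t\ge 0$. The maximal decay rate for the mode $k$ is the supremum of the decay rates of $y_k$ ($+\infty$ if $y_k\equiv0$); ''at least $d$'' is required for every solution satisfying the zero-mean assumption. *)

(* Defs.v *)
From HB Require Import structures.
From mathcomp Require Import all_boot all_order all_algebra.
From mathcomp Require Import complex.
From mathcomp Require Import all_classical all_reals all_analysis.

Set Implicit Arguments.
Unset Strict Implicit.
Unset Printing Implicit Defensive.

Import Order.TTheory GRing.Theory Num.Theory.
Import numFieldNormedType.Exports.

Local Open Scope classical_set_scope.
Local Open Scope ring_scope.

Section PeriodicFunctions.
Context {R : realType}.

Definition basis_vec {n : nat} (j : 'I_n) : 'rV[R]_n := delta_mx 0 j.

Definition periodic {n : nat} {T : Type} (f : 'rV[R]_n -> T) : Prop :=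
  forall (x : 'rV[R]_n) (j : 'I_n), f (x + basis_vec j) = f x.

(* The library has no n-dimensional Lebesgue measure, so the integral over
   [0,1]^n is the iterated one-dimensional Lebesgue integral, the first
   coordinate being integrated last. It is only applied to functions that are
   continuous on the cube. *)
Fixpoint cube_int {n : nat} : ('rV[R]_n -> R) -> R :=
  match n return ('rV[R]_n -> R) -> R with
  | 0%N => fun f => f 0
  | m.+1 => fun f =>
      Rintegral lebesgue_measure `[0, 1]
        (fun s : R => cube_int (fun y : 'rV[R]_m => f (row_mx s%:M y)))
  end.

Definition cube_cint {n : nat} (f : 'rV[R]_n -> R[i]) : R[i] :=
  Complex (cube_int (fun x => complex.Re (f x)))
          (cube_int (fun x => complex.Im (f x))).

Definition conv {n : nat} (phi f : 'rV[R]_n -> R) (x : 'rV[R]_n) : R :=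
  cube_int (fun y => phi (x - y) * f y).

Definition wave_sqnorm {n : nat} (k : 'rV[int]_n) : R :=
  \sum_j ((k 0 j)%:~R) ^+ 2.

Definition wave_norm {n : nat} (k : 'rV[int]_n) : R := Num.sqrt (wave_sqnorm k).

Definition wave_dot {n : nat} (k : 'rV[int]_n) (x : 'rV[R]_n) : R :=
  \sum_j (k 0 j)%:~R * x 0 j.

Definition expi (theta : R) : R[i] := Complex (cos theta) (sin theta).

Definition fourier_coef {n : nat} (f : 'rV[R]_n -> R) (k : 'rV[int]_n) : R[i] :=
  cube_cint (fun x => (f x)%:C%C * expi (- (2 * pi * wave_dot k x))).

(* A periodic function is isotropic when it is the periodization of a radial
   function on R^n. On the Fourier side, this says that its k-th coefficient
   depends only on |k|. *)
Definition isotropic {n : nat} (f : 'rV[R]_n -> R) : Prop :=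
  forall k l : 'rV[int]_n,
    wave_norm k = wave_norm l -> fourier_coef f k = fourier_coef f l.

Definition conv_kernel {n : nat} (phi : 'rV[R]_n -> R) : Prop :=
  [/\ continuous phi, periodic phi & isotropic phi].

End PeriodicFunctions.

Section ErrorSystem.
Context {R : realType} {n : nat}.

Definition partial (j : 'I_n) (f : 'rV[R]_n -> R) (x : 'rV[R]_n) : R :=
  derive f x (basis_vec j).

Definition component (w : 'rV[R]_n -> 'rV[R]_n) (j : 'I_n) (x : 'rV[R]_n) : R :=
  w x 0 j.

Definition divergence (w : 'rV[R]_n -> 'rV[R]_n) (x : 'rV[R]_n) : R :=
  \sum_j partial j (component w j) x.

Definition laplacian (f : 'rV[R]_n -> R) (x : 'rV[R]_n) : R :=
  \sum_j partial j (partial j f) x.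

Definition time_deriv (f : R -> 'rV[R]_n -> R) (t : R) (x : 'rV[R]_n) : R :=
  derive1 (fun s : R => f s x) t.

Definition jointly_continuous (f : R -> 'rV[R]_n -> R) : Prop :=
  forall (t : R) (x : 'rV[R]_n), 0 < t ->
    {for (t, x), continuous (fun p : R * 'rV[R]_n => f p.1 p.2)}.

Definition continuous_up_to_0 (f : R -> 'rV[R]_n -> R) : Prop :=
  {within [set p : R * 'rV[R]_n | 0 <= p.1],
    continuous (fun p : R * 'rV[R]_n => f p.1 p.2)}.

Definition C1_time (f : R -> 'rV[R]_n -> R) : Prop :=
  (forall (t : R) (x : 'rV[R]_n), 0 < t ->
     derivable (fun s : R => f s x) t 1) /\
  jointly_continuous (time_deriv f).

Definition C1_space (f : R -> 'rV[R]_n -> R) : Prop :=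
  forall j : 'I_n,
    (forall (t : R) (x : 'rV[R]_n), 0 < t ->
       derivable (f t) x (basis_vec j)) /\
    jointly_continuous (fun t => partial j (f t)).

Definition C2_space (f : R -> 'rV[R]_n -> R) : Prop :=
  C1_space f /\ forall j : 'I_n, C1_space (fun t => partial j (f t)).

Record error_solution (rho0 gamma mu lambda : R) (phi_rho phi_u : 'rV[R]_n -> R)
    (r : R -> 'rV[R]_n -> R) (v : R -> 'rV[R]_n -> 'rV[R]_n) : Prop :=
  ErrorSolution {
    r_periodic : forall t : R, 0 <= t -> periodic (r t);
    v_periodic : forall t : R, 0 <= t -> periodic (v t);
    r_continuous : continuous_up_to_0 r;
    v_continuous : forall j : 'I_n, continuous_up_to_0 (fun t => component (v t) j);
    r_C1_time : C1_time r;
    v_C1_time : forall j : 'I_n, C1_time (fun t => component (v t) j);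
    r_C1_space : C1_space r;
    v_C2_space : forall j : 'I_n, C2_space (fun t => component (v t) j);
    mass_eq : forall (t : R) (x : 'rV[R]_n), 0 < t ->
      time_deriv r t x + rho0 * divergence (v t) x =
      - rho0 * conv phi_rho (divergence (v t)) x;
    momentum_eq : forall (t : R) (x : 'rV[R]_n) (j : 'I_n), 0 < t ->
      rho0 * time_deriv (fun s => component (v s) j) t x =
      mu * laplacian (component (v t) j) x
      + (lambda + mu) * partial j (divergence (v t)) x
      - gamma * rho0 `^ (gamma - 1) * partial j (r t) x
      - rho0 * conv phi_u (component (v t) j) x }.

Definition zero_mean (r : R -> 'rV[R]_n -> R) : Prop :=
  forall t : R, 0 <= t -> cube_int (r t) = 0.

(* y_k(t) = (b_k(t), a_k(t)). *)
Definition mode (r : R -> 'rV[R]_n -> R) (v : R -> 'rV[R]_n -> 'rV[R]_n)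
    (k : 'rV[int]_n) (t : R) : 'rV[R[i]]_(1 + n) :=
  row_mx (fourier_coef (r t) k)%:M
         (\row_j fourier_coef (component (v t) j) k).

End ErrorSystem.

Section DecayRate.
Context {R : realType} {m : nat}.

Definition enorm (z : 'rV[R[i]]_m) : R :=
  Num.sqrt (\sum_j (complex.Re (z 0 j) ^+ 2 + complex.Im (z 0 j) ^+ 2)).

Definition decay_rate (y : R -> 'rV[R[i]]_m) (d : R) : Prop :=
  0 < d /\ exists2 c : R, 0 < c &
    forall t : R, 0 <= t -> enorm (y t) <= c * expR (- d * t).

Definition max_decay_rate (y : R -> 'rV[R[i]]_m) : \bar R :=
  ereal_sup [set d%:E | d in [set d : R | decay_rate y d]].

End DecayRate.

Section ExplicitKernels.
Context {R : realType} {n : nat}.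
Variables (rho0 gamma mu lambda d K : R).

Definition c1 : R := 4 * pi ^+ 2 * mu / rho0.
Definition c2 : R := 4 * pi ^+ 2 * (lambda + mu) / rho0.
Definition c5 : R := 4 * pi ^+ 2 * gamma * rho0 `^ (gamma - 1).

Definition phi_u_coef (k : 'rV[int]_n) : R :=
  if k == 0 then d
  else if wave_norm k <= K then
    Num.max 0 (Num.max (d - c1 * wave_sqnorm k)
                       (2 * d - (c1 + c2) * wave_sqnorm k))
  else 0.

Definition phi_rho_coef (k : 'rV[int]_n) : R :=
  if k == 0 then 0
  else if wave_norm k <= K then
    Num.max 0 (((c1 + c2) * wave_sqnorm k + phi_u_coef k) ^+ 2
               / (4 * c5 * wave_sqnorm k) - 1)
  else 0.

End ExplicitKernels.

(* Main.v *)
(** The kernels are finite trigonometric polynomials with the prescribed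
    (even, radial) coefficients. Expanding their translates by the addition
    formulas turns convolution with them into multiplication of Fourier
    coefficients by linearity of the iterated integral, without Fubini.

    Invariance of the integral of a periodic function under translation gives
    orthogonality of the waves (translate by a half period) and, after
    differentiating under the integral sign in the translation parameter,
    integration by parts. Testing the system against the wave [k] then yields
    an ODE in which the transverse part of [a_k] is damped at rate
    [m = c1 |k|^2 + phi_u], while [b_k] and the longitudinal part [k . a_k] form
    the oscillator [s^2 + A s + c5 |k|^2 (1 + phi_rho)] with
    [A = (c1 + c2) |k|^2 + phi_u]. The choice of [phi_u] makes [m >= d] and
    [A >= 2 d]; the choice of [phi_rho] makes the discriminant nonpositive, so
    that the real part of both roots is [- A / 2 <= - d]. *)

Require Import Defs.
From mathcomp Require Import all_boot all_order all_algebra.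
From mathcomp Require Import complex zify ring lra.
From mathcomp Require Import all_classical all_reals all_analysis.

Set Implicit Arguments.
Unset Strict Implicit.
Unset Printing Implicit Defensive.

Import Order.TTheory GRing.Theory Num.Theory.
Import numFieldNormedType.Exports.

Local Open Scope classical_set_scope.
Local Open Scope ring_scope.

(** * Continuity *)

Section Continuity.
Context {R : realType}.

Lemma continuous_mx (T U : topologicalType) m n (f : T -> 'M[U]_(m, n)) :
  (forall i j, continuous (fun t => f t i j)) -> continuous f.
Proof.
move=> cf t A [P Pt PA].
apply: (@filterS _ (nbhs t) _ [set s | forall i j, P i j (f s i j)]).
  by move=> s Ps; exact: PA.
by apply: filter_forall => i; apply: filter_forall => j; exact: (cf i j t).
Qed.

Lemma continuous_coord (T : topologicalType) m n (f : T -> 'M[R]_(m, n)) i j :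
  continuous f -> continuous (fun t => f t i j).
Proof.
move=> cf t; exact: (cvg_comp _ _ (cf t) (@coord_continuous _ _ _ i j (f t))).
Qed.

Lemma continuous_row_mx (T : topologicalType) n (s : T -> R) (y : T ->
  'rV[R]_n) :
  continuous s -> continuous y ->
  continuous (fun t => row_mx (s t)%:M (y t) : 'rV[R]_n.+1).
Proof.
move=> cs cy; apply: (@continuous_mx _ _ 1 (1 + n)) => i j.
rewrite (ord1 i); case: (split_ordP j) => l ->.
- rewrite (ord1 l); under eq_fun do rewrite row_mxEl mxE eqxx mulr1n.
  exact: cs.
- under eq_fun do rewrite row_mxEr; exact: continuous_coord.
Qed.

Lemma continuous_pair (T U V : topologicalType) (f : T -> U) (g : T -> V) :
  continuous f -> continuous g -> continuous (fun t => (f t, g t)).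
Proof. by move=> cf cg t; apply: cvg_pair; [exact: cf|exact: cg]. Qed.

Lemma continuous_compose (T U V : topologicalType) (f : T -> U) (g : U -> V) :
  continuous f -> continuous g -> continuous (fun t => g (f t)).
Proof. by move=> cf cg t; exact: (cvg_comp _ _ (cf t) (cg (f t))). Qed.

Lemma continuous_add (T : topologicalType) (V : normedModType R) (f g : T ->
  V) :
  continuous f -> continuous g -> continuous (fun t => f t + g t).
Proof. by move=> cf cg t; apply: cvgD; [exact: cf|exact: cg]. Qed.

Lemma continuous_opp (T : topologicalType) (V : normedModType R) (f : T -> V) :
  continuous f -> continuous (fun t => - f t).
Proof. by move=> cf t; apply: cvgN; exact: cf. Qed.

Lemma continuous_mul (T : topologicalType) (f g : T -> R) :
  continuous f -> continuous g -> continuous (fun t => f t * g t).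
Proof. by move=> cf cg t; apply: cvgM; [exact: cf|exact: cg]. Qed.

Lemma continuous_scale (T : topologicalType) (V : normedModType R)
    (f : T -> R) (g : T -> V) :
  continuous f -> continuous g -> continuous (fun t => f t *: g t).
Proof. by move=> cf cg t; apply: cvgZ; [exact: cf|exact: cg]. Qed.

Lemma continuous_sum (T : topologicalType) I (r : seq I) (f : I -> T -> R) :
  (forall i, continuous (f i)) -> continuous (fun t => \sum_(i <- r) f i t).
Proof.
move=> cf; elim: r => [|i r IH].
  by under eq_fun do rewrite big_nil; move=> t; exact: cvg_cst.
under eq_fun do rewrite big_cons; exact: continuous_add.
Qed.

(** A form of the tube lemma: each point x of the compact set has a product neighbourhood on which
    [F] stays within e/2 of [F t0 x], and compactness makes the neighbourhood of [t0] common to all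
    x. The triangle inequality through [F t0 x] then gives e. *)
Lemma tube (T X : topologicalType) (A : set X) (F : T -> X -> R) (t0 : T) :
  compact A ->
  (forall x, A x -> {for (t0, x), continuous (fun p => F p.1 p.2)}) ->
  forall e, 0 < e ->
  \forall t \near t0, forall x, A x -> `|F t x - F t0 x| < e.
Proof.
move=> /compact_near_coveringP cA cF e e0.
suff : \forall t \near t0, A `<=` (fun x => `|F t x - F t0 x| < e) by [].
apply: cA => x Ax.
have e2 : 0 < e / 2 by rewrite divr_gt0.
have /cvgrPdist_lt /(_ _ e2) [[U V] /= [Ut Vx] UV] := cF x Ax.
exists (V, U) => //= -[x' t] /= [Vx' Ut'].
have h1 := UV (t, x') (conj Ut' Vx').
have h2 := UV (t0, x') (conj (nbhs_singleton Ut) Vx').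
rewrite /= in h1 h2.
rewrite (_ : F t x' - F t0 x' = (F t0 x - F t0 x') - (F t0 x - F t x')).
  by rewrite (le_lt_trans (ler_normB _ _))// [ltRHS]splitr ltrD.
ring.
Qed.

End Continuity.

(* Naming [a] on the right of the constant-function branch makes the pattern
   reject bodies that mention the binder. *)
Ltac continuity := cbv beta; lazymatch goal with
  | |- forall x, continuous_at x (fun _ => row_mx _ _) =>
    apply: continuous_row_mx; continuity
  | |- forall x, continuous_at x (fun _ => (_, _)) => apply: continuous_pair;
    continuity
  | |- forall x, continuous_at x (fun _ => GRing.add _ _) =>
    apply: continuous_add; continuity
  | |- forall x, continuous_at x (fun _ => GRing.opp _) =>
    apply: continuous_opp; continuity
  | |- forall x, continuous_at x (fun _ => GRing.mul _ _) =>
    apply: continuous_mul; continuity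
  | |- forall x, continuous_at x (fun _ => GRing.scale _ _) =>
    apply: continuous_scale; continuity
  | |- forall x, continuous_at x (fun y => y) => move=> ?; exact: cvg_id
  | |- forall x, continuous_at x (fun _ => ?a) =>
    let b := constr:(a) in exact: cst_continuous
  | |- forall x, continuous_at x (fst) => move=> ?; exact: cvg_fst
  | |- forall x, continuous_at x (snd) => move=> ?; exact: cvg_snd
  | |- forall x, continuous_at x (fun y => fst y) => move=> ?; exact: cvg_fst
  | |- forall x, continuous_at x (fun y => snd y) => move=> ?; exact: cvg_snd
  | H : ?G |- ?G => exact H
  | |- _ => idtac
  end.

(** * The iterated integral of continuous functions *)

Section CubeIntegral.
Context {R : realType}.
Notation mu := (@lebesgue_measure R).

Lemma integrable01 (f : R -> R) :
  continuous f -> mu.-integrable `[0, 1] (EFin \o f).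
Proof.
move=> cf; apply: continuous_compact_integrable; first exact: segment_compact.
by apply: continuous_subspaceT => x; exact: cf.
Qed.

Lemma lebesgue_measure01 : fine (mu `[0, 1]%classic) = 1 :> R.
Proof. by rewrite lebesgue_measure_itv/= lte_fin ltr01 sube0. Qed.

Definition cube {n} : set 'rV[R]_n :=
  [set x | forall i, `[0, 1]%classic (x 0 i)].

Lemma compact_cube n : compact (@cube n).
Proof. by apply: (@rV_compact R n (fun=> `[0, 1]%classic)) => i;
  exact: segment_compact. Qed.

Lemma cube_row_mx n (s : R) (y : 'rV[R]_n) :
  `[0, 1]%classic s -> cube y -> cube (row_mx s%:M y).
Proof.
move=> s01 y01.
suff H (i : 'I_(1 + n)) : `[0, 1]%classic ((row_mx s%:M y : 'rV_(1 + n)) 0 i).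
  by move=> i; exact: H.
case: (split_ordP i) => j ->.
- by rewrite row_mxEl (ord1 j) mxE eqxx mulr1n.
- by rewrite row_mxEr.
Qed.

Lemma continuous_slice n (f : 'rV[R]_n.+1 -> R) (s : R) : continuous f ->
  continuous (fun y : 'rV[R]_n => f (row_mx s%:M y)).
Proof.
move=> cf; apply: continuous_compose (cf); apply: continuous_row_mx.
  exact: cst_continuous.
by move=> ?; exact: cvg_id.
Qed.

(** The three laws are bundled because they are proved by one induction on the dimension: each needs
    the inner integral to be integrable in the outer variable, and this comes from the laws one
    dimension lower. *)
Let integral_laws n := [/\
  forall f g : 'rV[R]_n -> R, continuous f -> continuous g ->
    cube_int (fun x => f x + g x) = cube_int f + cube_int g,
  forall (a : R) (f : 'rV[R]_n -> R), continuous f ->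
    cube_int (fun x => a * f x) = a * cube_int f &
  forall (f : 'rV[R]_n -> R) (M : R), continuous f ->
    (forall x, cube x -> `|f x| <= M) -> `|cube_int f| <= M].

(** By [tube], [F t] is uniformly close to [F t0] on the compact cube; linearity and the sup bound
    transfer this to the integrals. *)
Let param_continuous n : integral_laws n ->
  forall (T : topologicalType) (F : T -> 'rV[R]_n -> R),
  continuous (fun p : T * 'rV[R]_n => F p.1 p.2) ->
  continuous (fun t => cube_int (F t)).
Proof.
move=> [gD gZ gM] T F cF t0.
have cFt t : continuous (F t).
  apply: (continuous_compose (f := fun x => (t, x)) _ cF).
  by apply: continuous_pair; [exact: cst_continuous|move=> ?; exact: cvg_id].
apply/cvgrPdist_le => e e0.
have cF0 x : cube x -> {for (t0, x), continuous (fun p => F p.1 p.2)}.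
  by move=> _; exact: cF.
apply: filterS (tube (@compact_cube n) cF0 e0) => t Ht.
rewrite -mulN1r -gZ// -gD//; last by continuity.
apply: gM => [|x xc]; first by continuity.
by rewrite mulN1r distrC ltW// Ht.
Qed.

Let integral_lawsP n : integral_laws n.
Proof.
elim: n => [|n IH].
  (* In dimension 0 the integral is the value at the only point, which lies in the cube
     vacuously. *)
  split=> //= f M _; apply.
  by move=> -[].
have [gD gZ gM] := IH.
(* The inner integral is continuous in the outer coordinate, hence integrable on the unit
   interval. *)
have cI (f : 'rV[R]_n.+1 -> R) : continuous f ->
    continuous (fun s : R => cube_int (fun y : 'rV[R]_n => f (row_mx s%:M y))).
  move=> cf; apply: (param_continuous IH (F := fun s y => f (row_mx s%:M y))).
  apply: continuous_compose (cf); apply: continuous_row_mx.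
    by move=> ?; exact: cvg_fst.
  by move=> ?; exact: cvg_snd.
split=> /=.
- move=> f g cf cg; rewrite -RintegralD//; try exact: integrable01 (cI _ _).
  by apply: eq_Rintegral => s _; apply: gD; exact: continuous_slice.
- move=> a f cf; rewrite -RintegralZl//; try exact: integrable01 (cI _ _).
  by apply: eq_Rintegral => s _; apply: gZ; exact: continuous_slice.
- move=> f M cf fM.
  have cIf := cI _ cf.
  apply: le_trans (le_normr_Rintegral _ (integrable01 cIf)) _ => //.
  have -> : M = \int[mu]_(s in `[0, 1]) M.
    by rewrite Rintegral_cst// lebesgue_measure01 mulr1.
  apply: le_Rintegral => //.
  + apply: integrable01; apply: (continuous_compose cIf).
    by move=> ?; exact: norm_continuous.
  + by apply: integrable01; exact: cst_continuous.
  + move=> s s01; apply: gM; first exact: continuous_slice.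
    by move=> y yc; apply: fM; exact: cube_row_mx.
Qed.

Context {n : nat}.
Implicit Types f g : 'rV[R]_n -> R.

Lemma cube_intD f g : continuous f -> continuous g ->
  cube_int (fun x => f x + g x) = cube_int f + cube_int g.
Proof. by case: (@integral_lawsP n) => + _ _; exact. Qed.

Lemma cube_intZ (a : R) f : continuous f ->
  cube_int (fun x => a * f x) = a * cube_int f.
Proof. by case: (@integral_lawsP n) => _ + _; exact. Qed.

Lemma cube_int_le f (M : R) : continuous f ->
  (forall x, cube x -> `|f x| <= M) -> `|cube_int f| <= M.
Proof. by case: (@integral_lawsP n) => _ _; exact. Qed.

Lemma cube_int_continuous (T : topologicalType) (F : T -> 'rV[R]_n -> R) :
  continuous (fun p : T * 'rV[R]_n => F p.1 p.2) ->
  continuous (fun t => cube_int (F t)).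
Proof. exact: param_continuous (@integral_lawsP n) _ _. Qed.

Lemma eq_cube_int f g : f =1 g -> cube_int f = cube_int g.
Proof. by move=> /funext ->. Qed.

Lemma cube_intN f : continuous f ->
  cube_int (fun x => - f x) = - cube_int f.
Proof.
move=> cf; rewrite -mulN1r -cube_intZ//.
by apply: eq_cube_int => x; rewrite mulN1r.
Qed.

Lemma cube_intB f g : continuous f -> continuous g ->
  cube_int (fun x => f x - g x) = cube_int f - cube_int g.
Proof. by move=> cf cg; rewrite cube_intD ?cube_intN//; continuity. Qed.

Lemma cube_int_sum I (r : seq I) (F : I -> 'rV[R]_n -> R) :
  (forall i, continuous (F i)) ->
  cube_int (fun x => \sum_(i <- r) F i x) = \sum_(i <- r) cube_int (F i).
Proof.
move=> cF; elim: r => [|i r IH].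
  rewrite big_nil (eq_cube_int (g := fun x => 0 * cst 0 x)).
    by rewrite cube_intZ ?mul0r//; exact: cst_continuous.
  by move=> x; rewrite big_nil mul0r.
rewrite big_cons -IH -cube_intD//; last exact: continuous_sum.
by apply: eq_cube_int => x; rewrite big_cons.
Qed.

End CubeIntegral.

Lemma cube_int_cst (R : realType) n (a : R) :
  cube_int (fun _ : 'rV[R]_n => a) = a.
Proof.
elim: n => //= n IH; under eq_Rintegral do rewrite IH.
by rewrite Rintegral_cst// lebesgue_measure01 mulr1.
Qed.

(** * Differentiation under the integral sign *)

Section DerivativeUnderIntegral.
Context {R : realType}.

Lemma is_derive_cvg (V W : normedModType R) (f : V -> W) (x v : V) (l : W) :
  is_derive x v f l <-> h^-1 *: (f (h *: v + x) - f x) @[h --> 0^'] --> l.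
Proof.
split=> [[df <-]|cf]; first exact: df.
by apply: DeriveDef; [exact: cvgP cf|exact: cvg_lim cf].
Qed.

(** First-order expansion with error e times the increment: a division-free criterion, suited to
    estimates obtained by integrating. *)
Lemma is_derive_dist (f : R -> R) (x l : R) :
  (forall e, 0 < e -> \forall y \near x,
    `|f y - f x - (y - x) * l| <= e * `|y - x|) ->
  is_derive x 1 f l.
Proof.
move=> H.
apply/is_derive_cvg/cvgrPdist_le => e e0.
have [d /= d0 dP] := H e e0.
near=> h.
have h0 : h != 0 by near: h; exact: nbhs_dnbhs_neq.
have : `|f (h + x) - f x - h * l| <= e * `|h|.
  have hx : `|x - (h + x)| < d.
    by rewrite opprD addrCA subrr addr0 normrN; near: h; exact: dnbhs0_lt.
  by have := dP _ hx; rewrite /= addrK.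
rewrite -ler_pdivrMr ?normr_gt0//; apply: le_trans.
rewrite -normrV ?unitfE// -normrM distrC /GRing.scale/= mulr1.
by rewrite le_eqVlt; apply/orP; left; apply/eqP; congr `|_|; field.
Unshelve. all: end_near. Qed.

(** The remainder [F t y - F t0 y - (t - t0) * G t0 y] is controlled by the mean value theorem,
    uniformly in y on the cube thanks to [tube], and then integrated. *)
Lemma is_derive_cube_int n (F G : R -> 'rV[R]_n -> R) (t0 : R) :
  (\forall t \near t0, continuous (F t)) ->
  (\forall t \near t0, forall y, is_derive (t : R) 1 (fun s : R =>
    F s y) (G t y)) ->
  (forall y, {for (t0, y), continuous (fun p => G p.1 p.2)}) ->
  is_derive t0 1 (fun s => cube_int (F s)) (cube_int (G t0)).
Proof.
move=> cF dF cG.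
have cFt0 : continuous (F t0) := nbhs_singleton cF.
have cGt0 : continuous (G t0).
  have ct0 : continuous (fun y : 'rV[R]_n => (t0, y)).
    by apply: continuous_pair; [exact: cst_continuous|move=> ?; exact: cvg_id].
  by move=> y; exact: (cvg_comp _ _ (ct0 y) (cG y)).
apply: is_derive_dist => e e0.
have tG := tube (@compact_cube R n) (fun y _ => cG y) e0.
have [d /= d0 Hd] : exists2 d : R, 0 < d & forall t, `|t0 - t| < d ->
    [/\ continuous (F t), forall y, is_derive (t : R) 1 (fun s : R =>
      F s y) (G t y) &
        forall y, cube y -> `|G t y - G t0 y| < e].
  have [d d0 dP] : \forall t \near t0,
    [/\ continuous (F t), forall y, is_derive (t : R) 1 (fun s : R =>
      F s y) (G t y) &
        forall y, cube y -> `|G t y - G t0 y| < e].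
    by near=> t; split; near: t.
  by exists d.
(* The auxiliary function [F s y - s * G t0 y] has derivative [G s y - G t0 y], which is smaller
   than e near [t0]. Ordering a and b lets one estimate serve both sides of [t0]. *)
have mvt y a b : cube y -> a <= b -> `|t0 - a| < d -> `|t0 - b| < d ->
    `|(F b y - b * G t0 y) - (F a y - a * G t0 y)| <= e * (b - a).
  move=> cy ab ha hb.
  have hc c : a <= c <= b -> `|t0 - c| < d.
    by move: ha hb; rewrite !ltr_norml => /andP[? ?] /andP[? ?] /andP[? ?]; lra.
  have dg c : c \in `[a, b] ->
      is_derive c 1 (fun s => F s y - s * G t0 y) (G c y - G t0 y).
    rewrite in_itv/= => /hc /Hd [_ /(_ y) dFc _].
    apply: is_deriveB; rewrite -[X in is_derive _ _ _ X]mul1r.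
    apply: (is_derive_eq (is_deriveM _ _)).
    by rewrite scaler0 add0r /GRing.scale/= mulr1 mul1r.
  have cg : {within `[a, b], continuous (fun s => F s y - s * G t0 y)}.
    by apply: derivable_within_continuous => c /dg [].
  have [c cab gE] := MVT_segment ab (fun c hc => dg c (subset_itv_oo_cc hc)) cg.
  rewrite {}gE.
  have [_ _ /(_ y cy) /ltW Gc] := Hd c (hc c cab).
  by rewrite normrM (ger0_norm (x := b - a)) ?subr_ge0// ler_wpM2r ?subr_ge0.
exists d => //= t td; have [cFt _ _] := Hd t td.
rewrite -cube_intB// -cube_intZ// -cube_intB; [|by continuity..].
have t0d : `|t0 - t0| < d by rewrite subrr normr0.
apply: cube_int_le => [|y cy]; first by continuity.
have [tt0|/ltW tt0] := leP t0 t.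
- rewrite (ger0_norm (x := t - t0)) ?subr_ge0//.
  by apply: le_trans (mvt y _ _ cy tt0 t0d td); rewrite le_eqVlt; apply/orP;
    left; apply/eqP; congr `|_|; ring.
- rewrite (ler0_norm (x := t - t0)) ?subr_le0// opprB.
  apply: le_trans (mvt y _ _ cy tt0 td t0d).
  by rewrite -normrN le_eqVlt; apply/orP; left; apply/eqP; congr `|_|; ring.
Unshelve. all: end_near. Qed.

End DerivativeUnderIntegral.

(** * Translation invariance of the integral of a periodic function *)

Section Translation.
Context {R : realType}.
Notation mu := (@lebesgue_measure R).

(** The integral from c is a primitive; the fundamental theorem is applied on [c, x + 1] so that x
    is an interior point. *)
Lemma primitive_above (g : R -> R) (c : R) : continuous g ->
  exists F : R -> R, forall x, c < x -> is_derive x 1 F (g x).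
Proof.
move=> cg; exists (fun x => \int[mu]_(t in `[c, x]) g t) => x cx.
have ig : mu.-integrable `[c, x + 1] (EFin \o g).
  apply: continuous_compact_integrable; first exact: segment_compact.
  by apply: continuous_subspaceT => y; exact: cg.
have xx1 : x < x + 1 by rewrite ltrDl.
have [dF F'] := continuous_FTC1_closed xx1 ig cx (cg x).
by rewrite -F' derive1E; exact: derivableP.
Qed.

Lemma is_derive_shift (F : R -> R) (a x l : R) :
  is_derive (x + a) 1 F l -> is_derive x 1 (fun s => F (s + a)) l.
Proof.
move=> dF.
have da : is_derive x 1 (fun s : R => s + a) 1.
  by apply: is_derive_eq (addr0 _).
by have := is_derive1_comp (f := F) (g := fun s => s + a) dF da; rewrite mulr1.
Qed.

Lemma Rintegral_shift_primitive (g F : R -> R) (a : R) : continuous g ->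
  (forall x : R, 0 <= x <= 1 -> is_derive (x + a) 1 F (g (x + a))) ->
  \int[mu]_(s in `[0, 1]) g (s + a) = F (1 + a) - F a.
Proof.
move=> cg dF; rewrite /Rintegral.
have dFa (x : R) : 0 <= x <= 1 ->
  is_derive x 1 (fun s => F (s + a)) (g (x + a)).
  by move=> /dF; exact: is_derive_shift.
have cFa (x : R) : 0 <= x <= 1 -> {for x, continuous (fun s => F (s + a))}.
  by move=> /dFa [dx _]; apply: differentiable_continuous;
    exact/derivable1_diffP.
rewrite (@continuous_FTC2 R (fun s => g (s + a)) (fun s =>
  F (s + a)))//= ?add0r//.
- apply: continuous_subspaceT; apply: continuous_compose (cg).
  by apply: continuous_add; [move=> ?; exact: cvg_id|exact: cst_continuous].
- split.
  + by move=> x; rewrite in_itv/= => /andP[/ltW x0 /ltW x1]; have [] := dFa x;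
    rewrite ?x0.
  + by apply: cvg_at_right_filter; apply: cFa; rewrite lexx ler01.
  + by apply: cvg_at_left_filter; apply: cFa; rewrite lexx ler01.
- move=> x; rewrite in_itv/= => /andP[/ltW x0 /ltW x1].
  by have [|_] := dFa x; rewrite ?x0 ?derive1E.
Qed.

(** With F a primitive of g, the shifted integral equals [D a = F (a + 1) - F a]. The derivative of
    D is g(s + 1) - g(s) = 0, so D is constant. *)
Lemma Rintegral_periodic_shift (g : R -> R) (a : R) :
  continuous g -> (forall x, g (x + 1) = g x) ->
  \int[mu]_(s in `[0, 1]) g (s + a) = \int[mu]_(s in `[0, 1]) g s.
Proof.
(* The base point - |a| - 1 lies strictly below every point at which the primitive is
   differentiated, for shifts of either sign. *)
move=> cg pg; have [F dF] := primitive_above (- `|a| - 1) cg.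
have aN : - `|a| <= a <= `|a| by rewrite -ler_norml.
have Na := normr_ge0 a.
pose D s := F (s + 1) - F s.
have dD s : - `|a| <= s <= `|a| -> is_derive s 1 D 0.
  move=> /andP[s1 s2]; rewrite /D.
  have d1 : is_derive (s + 1) 1 F (g s) by rewrite -pg; apply: dF; lra.
  have d2 : is_derive s 1 F (g s) by apply: dF; lra.
  rewrite -(subrr (g s)); apply: is_deriveB; exact: is_derive_shift.
have Dcst x y : - `|a| <= x -> y <= `|a| -> x <= y -> D y = D x.
  move=> ax ya xy.
  have dxy s : s \in `[x, y] -> is_derive s 1 D 0.
    by rewrite in_itv/= => /andP[? ?]; apply: dD;
      rewrite (le_trans ax) ?(le_trans _ ya).
  have cD : {within `[x, y], continuous D}.
    by apply: derivable_within_continuous => s /dxy [].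
  have [s _] := MVT_segment xy (fun c hc => dxy c (subset_itv_oo_cc hc)) cD.
  by rewrite mul0r => /eqP; rewrite subr_eq0 => /eqP.
have dF1 (b x : R) : - `|a| <= b -> 0 <= x <= 1 ->
  is_derive (x + b) 1 F (g (x + b)).
  by move=> ? /andP[? ?]; apply: dF; lra.
have H b : - `|a| <= b -> \int[mu]_(s in `[0, 1]) g (s + b) = D b.
  move=> ab; rewrite (Rintegral_shift_primitive cg (fun x => dF1 b x ab)).
  by rewrite /D (addrC 1).
rewrite H; last by case/andP: aN.
transitivity (D 0).
  2: by rewrite -H ?oppr_le0//; apply: eq_Rintegral => s _; rewrite addr0.
case/andP: aN => aN1 aN2.
by have [a0|/ltW a0] := leP 0 a; [apply: Dcst|apply/esym/Dcst] => //;
  rewrite ?oppr_le0.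
Qed.

Lemma basis_vec_rshift n (j : 'I_n) :
  basis_vec (rshift 1 j) = row_mx 0 (basis_vec j) :> 'rV[R]_(1 + n).
Proof.
apply/rowP => i; case: (split_ordP i) => l ->.
  by rewrite row_mxEl !mxE eq_shift andbF.
by rewrite row_mxEr !mxE eq_shift.
Qed.

Lemma basis_vec_lshift n :
  basis_vec (lshift n 0) = row_mx 1%:M 0 :> 'rV[R]_(1 + n).
Proof.
apply/rowP => i; case: (split_ordP i) => l ->.
  by rewrite row_mxEl !mxE (ord1 l) eqxx.
by rewrite row_mxEr !mxE eq_shift andbF.
Qed.

Lemma periodic_slice n (f : 'rV[R]_n.+1 -> R) (s : R) : Defs.periodic f ->
  Defs.periodic (fun y : 'rV[R]_n => f (row_mx s%:M y)).
Proof.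
move=> pf y j.
have E : row_mx s%:M y + basis_vec (rshift 1 j) = row_mx s%:M (y + basis_vec j)
    :> 'rV[R]_(1 + n).
  by rewrite basis_vec_rshift add_row_mx addr0.
by rewrite -(pf (row_mx s%:M y) (rshift 1 j)); congr f; exact: esym E.
Qed.

(** Induction on the dimension: the inner coordinates are shifted by the induction hypothesis, the
    first one by the one-dimensional result. *)
Lemma cube_int_shift n (f : 'rV[R]_n -> R) (a : 'rV[R]_n) :
  continuous f -> Defs.periodic f -> cube_int (fun x => f (x + a)) = cube_int f.
Proof.
elim: n f a => [|n IH] f a cf pf /=.
  by congr f; apply/rowP => -[].
have aE : a = row_mx (a 0 0)%:M (@rsubmx R 1 1 n a) :> 'rV[R]_(1 + n).
  rewrite -[LHS](@hsubmxK R 1 1 n); congr (row_mx _ _).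
  by rewrite [LHS]mx11_scalar mxE; congr (a _ _)%:M; exact/val_inj.
pose g (s : R) := cube_int (fun y : 'rV[R]_n => f (row_mx s%:M y)).
rewrite -(@Rintegral_periodic_shift g (a 0 0)).
- apply: eq_Rintegral => s _; rewrite /g.
  rewrite -(IH (fun y => f (row_mx (s + a 0 0)%:M y)) (@rsubmx R 1 1 n a)).
  + apply: eq_cube_int => y; congr f; rewrite [in LHS]aE.
    have E : row_mx s%:M y + row_mx (a 0 0)%:M (@rsubmx R 1 1 n a) =
        row_mx (s + a 0 0)%:M (y + @rsubmx R 1 1 n a) :> 'rV[R]_(1 + n).
      by rewrite add_row_mx -raddfD.
    exact: E.
  + exact: continuous_slice.
  + exact: periodic_slice.
- apply: (cube_int_continuous (F := fun s y => f (row_mx s%:M y))).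
  apply: continuous_compose (cf); apply: continuous_row_mx.
    by move=> ?; exact: cvg_fst.
  by move=> ?; exact: cvg_snd.
- move=> s; apply: eq_cube_int => y.
  have E : row_mx s%:M y + basis_vec (lshift n 0) = row_mx (s + 1)%:M y
      :> 'rV[R]_(1 + n).
    by rewrite basis_vec_lshift add_row_mx addr0 -raddfD.
  by rewrite -(pf (row_mx s%:M y) (lshift n (0 : 'I_1))); congr f;
    exact: esym E.
Qed.

End Translation.

(** * Integration by parts for periodic functions *)

Section IntegrationByParts.
Context {R : realType} {n : nat}.
Implicit Types f g : 'rV[R]_n -> R.

(** Both sides have the same difference quotients; directional derivatives thus become ordinary
    derivatives along a line. *)
Lemma is_derive_line f (y v : 'rV[R]_n) (t l : R) :
  is_derive t 1 (fun s : R => f (y + s *: v)) l <-> is_derive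
    (y + t *: v) v f l.
Proof.
split=> /is_derive_cvg H; apply/is_derive_cvg; apply: cvg_trans H;
  apply: near_eq_cvg; apply: nearW => h /=; congr (_ *: (f _ - _));
  by rewrite [h *: 1]mulr1 scalerDl addrCA.
Qed.

Lemma is_derive_line0 f (y v : 'rV[R]_n) (l : R) :
  is_derive (0 : R) 1 (fun s : R => f (y + s *: v)) l -> is_derive y v f l.
Proof. by move=> /is_derive_line; rewrite scale0r addr0. Qed.

Definition C1_dir (j : 'I_n) f :=
  (forall x, derivable f x (basis_vec j)) /\ continuous (partial j f).

(** The integral of the translate of f by [s *: e] does not depend on s, and its derivative at s = 0
    is the integral of the partial derivative. *)
Lemma cube_int_partial j f : continuous f -> Defs.periodic f -> C1_dir j f ->
  cube_int (partial j f) = 0.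
Proof.
move=> cf pf [df cdf]; set e : 'rV[R]_n := basis_vec j.
pose F s (y : 'rV[R]_n) := f (y + s *: e).
pose G s (y : 'rV[R]_n) := partial j f (y + s *: e).
have : is_derive (0 : R) 1 (fun s => cube_int (F s)) (cube_int (G 0)).
  apply: is_derive_cube_int.
  - near=> t; apply: continuous_compose (cf).
    by continuity.
  - by near=> t => y; apply/is_derive_line/derivableP.
  - have cp : continuous (fun p : R * 'rV[R]_n => p.2 + p.1 *: e).
      by continuity.
    by move=> y; exact: (continuous_compose cp cdf).
have -> : (fun s => cube_int (F s)) = cst (cube_int f).
  by apply/funext => s; exact: cube_int_shift.
have -> : G 0 = partial j f by apply/funext => y; rewrite /G scale0r addr0.
by move=> [_ <-]; rewrite derive_cst.
Unshelve. all: end_near. Qed.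

(** The previous lemma is applied to the product of f and g, expanded by the Leibniz rule. *)
Lemma cube_int_by_parts j f g : continuous f -> Defs.periodic f -> C1_dir j f ->
  continuous g -> Defs.periodic g -> C1_dir j g ->
  cube_int (fun x => partial j f x * g x) = - cube_int (fun x =>
    f x * partial j g x).
Proof.
move=> cf pf [df cdf] cg pg [dg cdg].
have dfg x : is_derive x (basis_vec j) (fun x => f x * g x)
    (f x * partial j g x + g x * partial j f x).
  by apply: is_deriveM; exact: derivableP.
have E : partial j (fun x => f x * g x) =
    (fun x => partial j f x * g x + f x * partial j g x).
  by apply/funext => x; rewrite /partial derive_val addrC [_ * g x]mulrC.
apply/eqP; rewrite -addr_eq0 -cube_intD; [|by continuity..].
rewrite -E cube_int_partial; [by []|by continuity|by move=> x k;
  rewrite pf pg|].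
by split=> [x|]; [have [] := dfg x|rewrite E; continuity].
Qed.

End IntegrationByParts.

(** * Waves and Fourier coefficients *)

Section Waves.
Context {R : realType} {n : nat}.
Implicit Types (k l : 'rV[int]_n) (x y : 'rV[R]_n) (f : 'rV[R]_n -> R).

Definition cosw k x : R := cos (2 * pi * wave_dot k x).
Definition sinw k x : R := sin (2 * pi * wave_dot k x).

Lemma wave_dotDr k x y : wave_dot k (x + y) = wave_dot k x + wave_dot k y.
Proof. by rewrite -big_split; apply: eq_bigr => j _; rewrite mxE mulrDr. Qed.

Lemma wave_dotZr k (a : R) x : wave_dot k (a *: x) = a * wave_dot k x.
Proof. by rewrite mulr_sumr; apply: eq_bigr => j _; rewrite mxE mulrCA. Qed.

Lemma wave_dotDl k l x : wave_dot (k + l) x = wave_dot k x + wave_dot l x.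
Proof. by rewrite -big_split; apply: eq_bigr => j _;
  rewrite mxE intrD mulrDl. Qed.

Lemma wave_dotNl k x : wave_dot (- k) x = - wave_dot k x.
Proof.
by rewrite /wave_dot -sumrN; apply: eq_bigr => j _; rewrite mxE intrN mulNr.
Qed.

Lemma wave_dotNr k x : wave_dot k (- x) = - wave_dot k x.
Proof. by rewrite -scaleN1r wave_dotZr mulN1r. Qed.

Lemma wave_dot0l x : wave_dot 0 x = 0.
Proof. by rewrite /wave_dot big1// => j _; rewrite mxE mul0r. Qed.

Lemma wave_dot_basis k j : wave_dot k (basis_vec j : 'rV[R]_n) = (k 0 j)%:~R.
Proof.
rewrite /wave_dot (bigD1 j)//= big1 ?addr0; first by rewrite mxE !eqxx mulr1.
by move=> i ij; rewrite mxE eqxx (negbTE ij) mulr0.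
Qed.

Lemma cosD2piz (a : R) (z : int) : cos (a + 2 * pi * z%:~R) = cos a.
Proof.
have H b m : cos (b + 2 * pi * m%:R) = cos b :> R.
  rewrite -[RHS](periodicn (@cosD2pi R) m b); congr (cos (_ + _)).
  by rewrite -[RHS]mulr_natr -[pi *+ 2]mulr_natl.
case: z => m; first by rewrite -pmulrn H.
by rewrite NegzE intrN mulrN -pmulrn -[LHS](H _ m.+1) subrK.
Qed.

Lemma sinD2piz (a : R) (z : int) : sin (a + 2 * pi * z%:~R) = sin a.
Proof.
by rewrite -[LHS]cosBpihalf -[RHS]cosBpihalf addrAC cosD2piz.
Qed.

Lemma cosw_periodic k : Defs.periodic (cosw k).
Proof. by move=> x j; rewrite /cosw wave_dotDr wave_dot_basis mulrDr cosD2piz.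
  Qed.

Lemma sinw_periodic k : Defs.periodic (sinw k).
Proof. by move=> x j; rewrite /sinw wave_dotDr wave_dot_basis mulrDr sinD2piz.
  Qed.

Lemma wave_dot_continuous k : continuous (wave_dot k : 'rV[R]_n -> R).
Proof.
apply: continuous_sum => j; continuity; apply: (continuous_coord (f := id));
  continuity.
Qed.

Lemma cosw_continuous k : continuous (cosw k).
Proof.
apply: continuous_compose (@continuous_cos R); continuity;
  exact: wave_dot_continuous.
Qed.

Lemma sinw_continuous k : continuous (sinw k).
Proof.
apply: continuous_compose (@continuous_sin R); continuity;
  exact: wave_dot_continuous.
Qed.

Lemma is_derive_affine (a b t : R) : is_derive t 1 (fun s : R => a + s * b) b.
Proof.
apply: is_derive_dist => e e0; near=> y.
have -> : a + y * b - (a + t * b) - (y - t) * b = 0 by ring.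
by rewrite normr0 mulr_ge0// ltW.
Unshelve. all: end_near. Qed.

Lemma cosw_derive k j x :
  is_derive x (basis_vec j) (cosw k) (- (2 * pi * (k 0 j)%:~R) * sinw k x).
Proof.
apply: is_derive_line0.
have -> : (fun s : R => cosw k (x + s *: basis_vec j)) =
    cos \o (fun s => 2 * pi * wave_dot k x + s * (2 * pi * (k 0 j)%:~R)).
  apply/funext => s; rewrite /cosw/= wave_dotDr wave_dotZr wave_dot_basis.
  by congr cos; ring.
set a := 2 * pi * wave_dot k x; set b := 2 * pi * (k 0 j)%:~R.
have := @is_derive1_comp R cos (fun s => a + s * b) 0 _ _ (is_derive_cos _)
  (is_derive_affine a b 0).
by rewrite mul0r addr0 !mulNr mulrC.
Qed.

Lemma sinw_derive k j x :
  is_derive x (basis_vec j) (sinw k) (2 * pi * (k 0 j)%:~R * cosw k x).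
Proof.
apply: is_derive_line0.
have -> : (fun s : R => sinw k (x + s *: basis_vec j)) =
    sin \o (fun s => 2 * pi * wave_dot k x + s * (2 * pi * (k 0 j)%:~R)).
  apply/funext => s; rewrite /sinw/= wave_dotDr wave_dotZr wave_dot_basis.
  by congr sin; ring.
set a := 2 * pi * wave_dot k x; set b := 2 * pi * (k 0 j)%:~R.
have := @is_derive1_comp R sin (fun s => a + s * b) 0 _ _ (is_derive_sin _)
  (is_derive_affine a b 0).
by rewrite mul0r addr0 mulrC.
Qed.

(** Translation by a leaves the integral unchanged and also negates it. *)
Lemma cube_int_antiperiodic f (a : 'rV[R]_n) : continuous f ->
  Defs.periodic f ->
  (forall x, f (x + a) = - f x) -> cube_int f = 0.
Proof.
move=> cf pf fa; have := cube_int_shift a cf pf.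
by rewrite (eq_cube_int fa) cube_intN// => ?; lra.
Qed.

(** If the coordinate k_j is nonzero, the witness is the basis vector e_j divided by 2 k_j.
    Translating by it changes the phase by pi. *)
Lemma wave_half_period k : k != 0 -> exists a : 'rV[R]_n, wave_dot k a = 2^-1.
Proof.
move=> k0; have /existsP[j kj0] : [exists j, k 0 j != 0].
  apply: contraNT k0; rewrite negb_exists => /forallP H.
  by apply/eqP/rowP => j; rewrite mxE; apply/eqP; have := H j; rewrite negbK.
exists ((2 * (k 0 j)%:~R)^-1 *: basis_vec j).
by rewrite wave_dotZr wave_dot_basis invfM mulfVK// intr_eq0.
Qed.

Lemma cube_int_cosw k : cube_int (cosw k) = (k == 0)%:R.
Proof.
have [->|k0] := eqVneq k 0.
  rewrite -[RHS](@cube_int_cst R n); apply: eq_cube_int => x.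
  by rewrite /cosw wave_dot0l mulr0 cos0.
have [a ka] := wave_half_period k0.
apply: (cube_int_antiperiodic (a := a)).
- exact: cosw_continuous.
- exact: cosw_periodic.
- by move=> x; rewrite /cosw wave_dotDr ka mulrDr (_ : 2 * pi / 2
  = pi) ?cosDpi//; field.
Qed.

Lemma cube_int_sinw k : cube_int (sinw k) = 0.
Proof.
have [->|k0] := eqVneq k 0.
  rewrite -[RHS](@cube_int_cst R n); apply: eq_cube_int => x.
  by rewrite /sinw wave_dot0l mulr0 sin0.
have [a ka] := wave_half_period k0.
apply: (cube_int_antiperiodic (a := a)).
- exact: sinw_continuous.
- exact: sinw_periodic.
- by move=> x; rewrite /sinw wave_dotDr ka mulrDr (_ : 2 * pi / 2
  = pi) ?sinDpi//; field.
Qed.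

End Waves.

(** * Real cosine and sine coefficients *)

Section FourierCoefficients.
Context {R : realType} {n : nat}.
Implicit Types (k l : 'rV[int]_n) (x y : 'rV[R]_n) (f g : 'rV[R]_n -> R).

Definition cos_coef f k : R := cube_int (fun x => f x * cosw k x).
Definition sin_coef f k : R := cube_int (fun x => f x * sinw k x).

(** The sine part enters with a minus sign because the coefficient is taken against the conjugate
    wave. From here on all computations are done on the two real coefficients. *)
Lemma fourier_coefE f k : continuous f ->
  fourier_coef f k = Complex (cos_coef f k) (- sin_coef f k).
Proof.
move=> cf; have csk := @sinw_continuous R n k.
rewrite /cos_coef /sin_coef -cube_intN; last by continuity.
congr Complex; apply: eq_cube_int => x /=.
- by rewrite mul0r subr0 cosN.
- by rewrite mul0r addr0 sinN mulrN.
Qed.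

Lemma cos_coef_lin f g (a b : R) k : continuous f -> continuous g ->
  cos_coef (fun x => a * f x + b * g x) k = a * cos_coef f k + b * cos_coef g k.
Proof.
move=> cf cg; have cck := @cosw_continuous R n k.
rewrite /cos_coef -!cube_intZ -?cube_intD; [|by continuity..].
by apply: eq_cube_int => x; ring.
Qed.

Lemma sin_coef_lin f g (a b : R) k : continuous f -> continuous g ->
  sin_coef (fun x => a * f x + b * g x) k = a * sin_coef f k + b * sin_coef g k.
Proof.
move=> cf cg; have csk := @sinw_continuous R n k.
rewrite /sin_coef -!cube_intZ -?cube_intD; [|by continuity..].
by apply: eq_cube_int => x; ring.
Qed.

Lemma cos_coef_sum I (r : seq I) (F : I -> 'rV[R]_n -> R) k :
  (forall i, continuous (F i)) ->
  cos_coef (fun x => \sum_(i <- r) F i x) k = \sum_(i <- r) cos_coef (F i) k.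
Proof.
move=> cF; have cck := @cosw_continuous R n k.
rewrite /cos_coef -cube_int_sum; last by move=> i; have ci := cF i; continuity.
by apply: eq_cube_int => x; rewrite mulr_suml.
Qed.

Lemma sin_coef_sum I (r : seq I) (F : I -> 'rV[R]_n -> R) k :
  (forall i, continuous (F i)) ->
  sin_coef (fun x => \sum_(i <- r) F i x) k = \sum_(i <- r) sin_coef (F i) k.
Proof.
move=> cF; have csk := @sinw_continuous R n k.
rewrite /sin_coef -cube_int_sum; last by move=> i; have ci := cF i; continuity.
by apply: eq_cube_int => x; rewrite mulr_suml.
Qed.

Lemma partial_cosw j k :
  partial j (cosw k) = fun x => - (2 * pi * (k 0 j)%:~R) * sinw k x :> R.
Proof. by apply/funext => x; have [_] := cosw_derive k j x. Qed.

Lemma partial_sinw j k :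
  partial j (sinw k) = fun x => 2 * pi * (k 0 j)%:~R * cosw k x :> R.
Proof. by apply/funext => x; have [_] := sinw_derive k j x. Qed.

Lemma C1_dir_cosw j k : C1_dir j (@cosw R n k).
Proof.
split=> [x|]; first by have [] := cosw_derive k j x.
by rewrite partial_cosw; have csk := @sinw_continuous R n k; continuity.
Qed.

Lemma C1_dir_sinw j k : C1_dir j (@sinw R n k).
Proof.
split=> [x|]; first by have [] := sinw_derive k j x.
by rewrite partial_sinw; have csk := @cosw_continuous R n k; continuity.
Qed.

Lemma cos_coef_partial j f k : continuous f -> Defs.periodic f -> C1_dir j f ->
  cos_coef (partial j f) k = 2 * pi * (k 0 j)%:~R * sin_coef f k.
Proof.
move=> cf pf df; have csk := @sinw_continuous R n k.
rewrite /cos_coef (cube_int_by_parts cf pf df (@cosw_continuous R n k)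
  (@cosw_periodic R n k) (C1_dir_cosw j k)).
rewrite partial_cosw /sin_coef -cube_intZ -?cube_intN; [|by continuity..].
by apply: eq_cube_int => x; ring.
Qed.

Lemma sin_coef_partial j f k : continuous f -> Defs.periodic f -> C1_dir j f ->
  sin_coef (partial j f) k = - (2 * pi * (k 0 j)%:~R) * cos_coef f k.
Proof.
move=> cf pf df; have csk := @cosw_continuous R n k.
rewrite /sin_coef (cube_int_by_parts cf pf df (@sinw_continuous R n k)
  (@sinw_periodic R n k) (C1_dir_sinw j k)).
rewrite partial_sinw /cos_coef -cube_intZ -?cube_intN; [|by continuity..].
by apply: eq_cube_int => x; ring.
Qed.

Lemma cosw_mul_cosw l k x :
  cosw l x * cosw k x = 2^-1 * cosw (l - k) x + 2^-1 * cosw (l + k) x :> R.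
Proof.
rewrite /cosw !wave_dotDl wave_dotNl.
by rewrite !mulrDr mulrN cosB cosD; field.
Qed.

Lemma sinw_mul_sinw l k x :
  sinw l x * sinw k x = 2^-1 * cosw (l - k) x + (- 2^-1) * cosw (l + k) x :> R.
Proof.
rewrite /cosw /sinw !wave_dotDl wave_dotNl.
by rewrite !mulrDr mulrN cosB cosD; field.
Qed.

Lemma cosw_mul_sinw l k x :
  cosw l x * sinw k x = 2^-1 * sinw (l + k) x + (- 2^-1) * sinw (l - k) x :> R.
Proof.
rewrite /cosw /sinw !wave_dotDl wave_dotNl.
by rewrite !mulrDr mulrN sinB sinD; field.
Qed.

Lemma cube_int_lin f g (a b : R) : continuous f -> continuous g ->
  cube_int (fun x => a * f x + b * g x) = a * cube_int f + b * cube_int g.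
Proof. by move=> cf cg; rewrite cube_intD ?cube_intZ//; continuity. Qed.

Lemma cos_coef_cosw l k :
  cos_coef (cosw l) k = 2^-1 * (l == k)%:R + 2^-1 * (l == - k)%:R.
Proof.
rewrite /cos_coef (eq_cube_int (cosw_mul_cosw l k)) cube_int_lin;
  try exact: cosw_continuous.
by rewrite !cube_int_cosw subr_eq0 addr_eq0.
Qed.

Lemma sin_coef_sinw l k :
  sin_coef (sinw l) k = 2^-1 * (l == k)%:R + (- 2^-1) * (l == - k)%:R.
Proof.
rewrite /sin_coef (eq_cube_int (sinw_mul_sinw l k)) cube_int_lin;
  try exact: cosw_continuous.
by rewrite !cube_int_cosw subr_eq0 addr_eq0.
Qed.

Lemma sin_coef_cosw l k : sin_coef (cosw l) k = 0.
Proof.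
rewrite /sin_coef (eq_cube_int (cosw_mul_sinw l k)) cube_int_lin;
  try exact: sinw_continuous.
by rewrite !cube_int_sinw !mulr0 addr0.
Qed.

Lemma cos_coef_sinw l k : cos_coef (sinw l) k = 0.
Proof.
by rewrite -(sin_coef_cosw k l); apply: eq_cube_int => x; rewrite mulrC.
Qed.

Lemma cos_coefN f k : cos_coef f (- k) = cos_coef f k.
Proof.
by apply: eq_cube_int => x; rewrite /cosw wave_dotNl mulrN cosN.
Qed.

Lemma sin_coefN f k : continuous f -> sin_coef f (- k) = - sin_coef f k.
Proof.
move=> cf; have csk := @sinw_continuous R n k; rewrite /sin_coef -cube_intN;
  last by continuity.
by apply: eq_cube_int => x; rewrite /sinw wave_dotNl mulrN sinN mulrN.
Qed.

End FourierCoefficients.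

(** * Convolution with an even trigonometric polynomial *)

Section TrigonometricKernel.
Context {R : realType} {n : nat}.
Variables (ks : seq 'rV[int]_n) (p : 'rV[int]_n -> R).
Hypotheses (uks : uniq ks) (pks : forall k, p k != 0 -> k \in ks).
Hypothesis (pN : forall k, p (- k) = p k).
Implicit Types (k l : 'rV[int]_n) (x y : 'rV[R]_n) (f : 'rV[R]_n -> R).

(** For even real p this is the exponential sum with coefficients p, as the waves l and -l have
    opposite sine parts; hence no factor 2 or 1/2 appears. *)
Definition trig_kernel x : R := \sum_(l <- ks) p l * cosw l x.

(** The formula holds for every k: outside [ks] the coefficient [p k] vanishes and no term of the
    sum matches k. *)
Lemma sum_delta (g : 'rV[int]_n -> R) k :
  \sum_(l <- ks) p l * (g l * (l == k)%:R) = p k * g k.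
Proof.
have [kks|kks] := boolP (k \in ks).
  rewrite (bigD1_seq k)//= eqxx mulr1 big1 ?addr0// => l /negbTE ->.
  by rewrite !mulr0.
have -> : p k = 0 by apply/eqP/negPn; apply: contra kks; exact: pks.
rewrite mul0r big_seq big1// => l lks; have [lk|_] := eqVneq l k.
  by move: kks; rewrite -lk lks.
by rewrite !mulr0.
Qed.

Lemma trig_kernel_continuous : continuous trig_kernel.
Proof.
apply: continuous_sum => l; have cl := @cosw_continuous R n l; continuity.
Qed.

Lemma trig_kernel_periodic : Defs.periodic trig_kernel.
Proof. by move=> x j; apply: eq_bigr => l _; rewrite cosw_periodic. Qed.

Let cpc l : continuous (fun x => p l * cosw l x : R).
Proof. have cl := @cosw_continuous R n l; continuity. Qed.

(** The cosine of index l contributes one half at l and one half at -l; the evenness of p adds the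
    two halves into [p k]. *)
Lemma fourier_coef_trig_kernel k : fourier_coef trig_kernel k = (p k)%:C%C.
Proof.
rewrite fourier_coefE; last exact: trig_kernel_continuous.
rewrite /trig_kernel cos_coef_sum// sin_coef_sum//; congr Complex; last first.
  rewrite big1 ?oppr0// => l _; have cl := @cosw_continuous R n l.
  rewrite /sin_coef -[RHS](mulr0 (p l)) -(sin_coef_cosw l k) -cube_intZ.
    by apply: eq_cube_int => x; rewrite mulrA.
  by have csk := @sinw_continuous R n k; continuity.
transitivity (\sum_(l <- ks) (p l * (2^-1 * (l == k)%:R) + p l * (2^-1 *
  (l == - k)%:R))).
  apply: eq_bigr => l _; rewrite -mulrDr -cos_coef_cosw -cube_intZ.
    by apply: eq_cube_int => x; rewrite mulrA.
  by have cl := @cosw_continuous R n l; have csk := @cosw_continuous R n k;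
    continuity.
by rewrite big_split/= (sum_delta (fun=> 2^-1)) (sum_delta (fun=> 2^-1)) pN;
  field.
Qed.

(** The addition formula for the cosine of l . (x - y) separates x from y, so that only integrals in
    y against waves remain. *)
Lemma conv_trig_kernel f x : continuous f ->
  Defs.conv trig_kernel f x =
  \sum_(l <- ks) p l * (cos_coef f l * cosw l x + sin_coef f l * sinw l x).
Proof.
move=> cf; rewrite /Defs.conv.
transitivity (cube_int (fun y => \sum_(l <- ks)
    ((p l * cosw l x) * (f y * cosw l y) + (p l * sinw l x) *
      (f y * sinw l y)))).
  apply: eq_cube_int => y; rewrite mulr_suml; apply: eq_bigr => l _.
  rewrite /cosw /sinw wave_dotDr wave_dotNr mulrBr cosB; ring.
have cl l := @cosw_continuous R n l; have sl l := @sinw_continuous R n l.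
rewrite cube_int_sum; last by move=> l; have cll := cl l; have sll := sl l;
  continuity.
apply: eq_bigr => l _; have cll := cl l; have sll := sl l.
rewrite cube_int_lin; [|by continuity..].
by rewrite /cos_coef /sin_coef; ring.
Qed.

Lemma conv_trig_kernel_continuous f : continuous f ->
  continuous (Defs.conv trig_kernel f).
Proof.
move=> cf; rewrite (_ : Defs.conv _ _ = fun x => \sum_(l <- ks)
    p l * (cos_coef f l * cosw l x + sin_coef f l * sinw l x)).
  apply: continuous_sum => l.
  have cl := @cosw_continuous R n l; have sl := @sinw_continuous R n l;
    continuity.
by apply/funext => x; exact: conv_trig_kernel.
Qed.

Lemma cos_coef_conv f k : continuous f ->
  cos_coef (Defs.conv trig_kernel f) k = p k * cos_coef f k.
Proof.
move=> cf.
have -> : Defs.conv trig_kernel f = fun x => \sum_(l <- ks)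
    ((p l * cos_coef f l) * cosw l x + (p l * sin_coef f l) * sinw l x).
  apply/funext => x; rewrite conv_trig_kernel//; apply: eq_bigr => l _; ring.
have cl l := @cosw_continuous R n l; have sl l := @sinw_continuous R n l.
rewrite cos_coef_sum; last by move=> l; have cll := cl l; have sll := sl l;
  continuity.
transitivity (\sum_(l <- ks) (p l * ((cos_coef f l / 2) * (l == k)%:R) +
    p l * ((cos_coef f l / 2) * (l == - k)%:R))).
  by apply: eq_bigr => l _; rewrite cos_coef_lin// cos_coef_cosw cos_coef_sinw;
    ring.
rewrite big_split/= (sum_delta (fun l => cos_coef f l / 2)).
by rewrite (sum_delta (fun l => cos_coef f l / 2)) pN cos_coefN; field.
Qed.

(** As for the cosine, k and -k each contribute one half; the sign in the sine orthogonality
    relation at -k is cancelled by the oddness of [sin_coef f]. *)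
Lemma sin_coef_conv f k : continuous f ->
  sin_coef (Defs.conv trig_kernel f) k = p k * sin_coef f k.
Proof.
move=> cf.
have -> : Defs.conv trig_kernel f = fun x => \sum_(l <- ks)
    ((p l * cos_coef f l) * cosw l x + (p l * sin_coef f l) * sinw l x).
  apply/funext => x; rewrite conv_trig_kernel//; apply: eq_bigr => l _; ring.
have cl l := @cosw_continuous R n l; have sl l := @sinw_continuous R n l.
rewrite sin_coef_sum; last by move=> l; have cll := cl l; have sll := sl l;
  continuity.
transitivity (\sum_(l <- ks) (p l * ((sin_coef f l / 2) * (l == k)%:R) +
    p l * (- (sin_coef f l / 2) * (l == - k)%:R))).
  by apply: eq_bigr => l _; rewrite sin_coef_lin// sin_coef_cosw sin_coef_sinw;
    ring.
rewrite big_split/= (sum_delta (fun l => sin_coef f l / 2)).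
by rewrite (sum_delta (fun l => - (sin_coef f l / 2))) pN sin_coefN//; field.
Qed.

End TrigonometricKernel.

(** * Decay for linear differential inequalities *)

Section LinearDecay.
Context {R : realType}.
Implicit Types (f g V : R -> R) (e t : R).

Lemma is_derive_add f g t (a b : R) : is_derive t 1 f a -> is_derive t 1 g b ->
  is_derive t 1 (fun s => f s + g s) (a + b).
Proof. by move=> df dg; exact: is_deriveD. Qed.

Lemma is_derive_mul f g t (a b : R) : is_derive t 1 f a -> is_derive t 1 g b ->
  is_derive t 1 (fun s => f s * g s) (f t * b + g t * a).
Proof. by move=> df dg; exact: is_deriveM. Qed.

Lemma is_derive_scale f t (c a : R) : is_derive t 1 f a ->
  is_derive t 1 (fun s => c * f s) (c * a).
Proof. by move=> df; exact: is_deriveZ. Qed.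

Lemma is_derive_sum_seq I (r : seq I) (F : I -> R -> R) (G : I -> R) t :
  (forall i, is_derive t 1 (F i) (G i)) ->
  is_derive t 1 (fun s => \sum_(i <- r) F i s) (\sum_(i <- r) G i).
Proof.
move=> dF; elim: r => [|i r IH].
  rewrite big_nil; under eq_fun do rewrite big_nil; exact: is_derive_cst.
rewrite big_cons; under eq_fun do rewrite big_cons; exact: is_derive_add.
Qed.

(** The product of V and exp(a t) has a nonpositive derivative for t > 0, so the mean value theorem
    on [0, t] bounds it by its value at 0. Continuity suffices at t = 0. *)
Lemma gronwall V (dV : R -> R) (a : R) : continuous V ->
  (forall t, 0 < t -> is_derive t 1 V (dV t)) ->
  (forall t, 0 < t -> dV t <= - a * V t) ->
  forall t, 0 <= t -> V t <= V 0 * expR (- a * t).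
Proof.
move=> cV dVt Va t; rewrite le_eqVlt => /predU1P[<-|t0].
  by rewrite mulr0 expR0 mulr1.
pose g s := V s * expR (a * s).
pose dg s := V s * (a * expR (a * s)) + expR (a * s) * dV s.
have dgP (s : R) : 0 < s -> is_derive s 1 g (dg s).
  move=> s0; apply: is_derive_mul; first exact: dVt.
  have dl : is_derive s 1 (fun s : R => a * s) a.
    by rewrite -[X in is_derive _ _ _ X]mulr1; apply: is_derive_scale;
      exact: is_derive_id.
  by have := is_derive1_comp (is_derive_expR (a * s)) dl; rewrite mulrC.
have cg : {within `[0, t], continuous g}.
  apply: continuous_subspaceT; rewrite /g.
  have ce : continuous (fun s => expR (a * s)).
    by apply: (continuous_compose (f := fun s : R =>
      a * s)) (@continuous_expR R); continuity.
  by continuity.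
have [|c] := @MVT R g dg 0 t t0 _ cg.
  by move=> s; rewrite in_itv/= => /andP[s0 _]; exact: (dgP s s0).
rewrite in_itv/= => /andP[c0 _] gE.
have : g t <= g 0.
  rewrite -subr_le0 gE subr0 pmulr_lle0// /dg.
  have -> : V c * (a * expR (a * c)) + expR (a * c) * dV c =
    expR (a * c) * (dV c - - a * V c) by ring.
  by rewrite pmulr_rle0 ?expR_gt0// subr_le0 Va.
rewrite /g mulr0 expR0 mulr1 -ler_pdivlMr ?expR_gt0// -expRN.
by rewrite mulNr.
Qed.

(** The sign of the constant is left free, which keeps sums and multiples simple; a positive
    constant is restored in [decays_decay_rate]. *)
Definition decays e f := exists c, forall t, 0 <= t ->
  `|f t| <= c * expR (- e * t).

Lemma decays_add e f g : decays e f -> decays e g ->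
  decays e (fun t => f t + g t).
Proof.
move=> [c cf] [c' cg]; exists (c + c') => t t0.
by rewrite mulrDl (le_trans (ler_normD _ _))// lerD ?cf ?cg.
Qed.

Lemma decays_scale e f (a : R) : decays e f -> decays e (fun t => a * f t).
Proof.
move=> [c cf]; exists (`|a| * c) => t t0.
by rewrite normrM -mulrA ler_wpM2l// cf.
Qed.

Lemma eq_decays e f g : (forall t, 0 <= t -> f t = g t) -> decays e f ->
  decays e g.
Proof. by move=> fg [c cf]; exists c => t t0; rewrite -fg// cf. Qed.

(** Quadratic Lyapunov functionals decay at rate 2 e; a square root gives rate e for the function
    itself. *)
Lemma decays_sqr e f (C : R) :
  (forall t, 0 <= t -> f t * f t <= C * expR (- (2 * e) * t)) -> decays e f.
Proof.
move=> H; exists (Num.sqrt C) => t t0.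
have C0 : 0 <= C.
  have := H 0 (lexx 0); rewrite mulr0 expR0 mulr1; apply: le_trans.
  by rewrite -expr2 sqr_ge0.
rewrite -ler_sqr ?nnegrE ?mulr_ge0 ?sqrtr_ge0 ?expR_ge0// exprMn sqr_sqrtr//.
rewrite real_normK ?num_real// -expRM_natl.
by rewrite expr2 (le_trans (H _ t0))// ler_wpM2l// ler_expR; lra.
Qed.

Lemma decays_first_order e f (m : R) : e <= m -> continuous f ->
  (forall t, 0 < t -> is_derive t 1 f (- m * f t)) -> decays e f.
Proof.
move=> em cf df; apply: (@decays_sqr _ _ (f 0 * f 0)) => t t0.
apply: (@gronwall (fun t => f t * f t) (fun t =>
  f t * (- m * f t) + f t * (- m * f t))) => //.
- by continuity.
- by move=> s s0; apply: is_derive_mul; exact: df.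
- by move=> s s0; have := sqr_ge0 (f s); nra.
Qed.

(* With [w = al z + (A/2) b] and [dl = al be - A^2/4 >= 0] the system becomes
   [b' = w - (A/2) b], [w' = -(A/2) w - dl b]. The form [w^2 + (dl + ep^2) b^2]
   decays at rate [A - ep]; the [ep^2] keeps it definite when [dl = 0], the case
   of a double root, where the solution is only [O(t e^{-At/2})]. *)
Lemma decays_second_order e b z (A al be : R) :
  2 * e < A -> 0 < al -> A ^+ 2 <= 4 * (al * be) ->
  continuous b -> continuous z ->
  (forall t, 0 < t -> is_derive t 1 b (al * z t)) ->
  (forall t, 0 < t -> is_derive t 1 z (- A * z t - be * b t)) ->
  decays e b /\ decays e z.
Proof.
move=> eA al0 Aab cb cz db dz.
pose ep := A - 2 * e; have ep0 : 0 < ep by rewrite subr_gt0.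
pose dl := al * be - (A / 2) ^+ 2.
have dl0 : 0 <= dl by rewrite /dl; nra.
pose w t := al * z t + A / 2 * b t.
pose q := dl + ep ^+ 2.
pose V t := w t * w t + q * (b t * b t).
pose dw t := - (A / 2) * w t - dl * b t.
have cw : continuous w by rewrite /w; continuity.
have dwP (t : R) : 0 < t -> is_derive t 1 w (dw t).
  move=> t0; have -> : dw t = al * (- A * z t - be * b t) + A / 2 * (al * z t).
    by rewrite /dw /w /dl; field.
  by apply: is_derive_add; apply: is_derive_scale; [exact: dz|exact: db].
pose dV t := (w t * dw t + w t * dw t) +
  q * (b t * (al * z t) + b t * (al * z t)).
have VE t : 0 <= t -> V t <= V 0 * expR (- (2 * e) * t).
  apply: (@gronwall V dV).
  - by rewrite /V; continuity.
  - move=> s s0; apply: is_derive_add; last apply: is_derive_scale.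
      by apply: is_derive_mul; exact: dwP.
    by apply: is_derive_mul; exact: db.
  (* Since 2 e = A - ep, the excess of dissipation is a sum of two squares with nonnegative
     weights. *)
  - move=> s _; rewrite -subr_ge0.
    have -> : - (2 * e) * V s - dV s
      = ep * (w s - ep * b s) ^+ 2 + ep * dl * b s ^+ 2.
      by rewrite /V /dV /dw /q /dl /w /ep; field.
    by rewrite addr_ge0// mulr_ge0 ?sqr_ge0 ?mulr_ge0// ltW.
(* V dominates ep^2 b^2 even when [dl] vanishes, which is why [ep * b] is estimated first and then
   divided by ep. *)
have bd : decays e (fun t => ep * b t).
  apply: (@decays_sqr _ _ (V 0)) => t t0; apply: le_trans (VE t t0).
  rewrite -subr_ge0 (_ : _ - _ = w t ^+ 2 + dl * b t ^+ 2); last first.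
    by rewrite /V /q; ring.
  by apply: addr_ge0; [exact: sqr_ge0|apply: mulr_ge0 => //; exact: sqr_ge0].
have wd : decays e w.
  apply: (@decays_sqr _ _ (V 0)) => t t0; apply: le_trans (VE t t0).
  rewrite /V lerDl; apply: mulr_ge0; last exact: sqr_ge0.
  by apply: addr_ge0 => //; exact: sqr_ge0.
have {}bd : decays e b.
  apply: eq_decays (decays_scale ep^-1 bd) => t _.
  by rewrite mulKf// gt_eqF.
split=> //; apply: eq_decays (decays_scale al^-1 (decays_add wd (decays_scale
  (- (A / 2)) bd))).
by move=> t _; rewrite /w mulNr addrK mulKf// gt_eqF.
Qed.

(* [B] and [u] decouple into the longitudinal part [Z = sum_j kap_j u_j], a
   damped oscillator together with [B], and the transverse components
   [u_j - (kap_j / |kap|^2) Z], each with damping [m]. *)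
Lemma decays_mode n e (d : R) (kap : 'I_n -> R) B (u : 'I_n -> R -> R)
    (m c al be : R) :
  let K2 := \sum_j kap j ^+ 2 in
  0 < K2 -> e < d -> d <= m -> 2 * d <= m + c * K2 -> 0 < al ->
  (m + c * K2) ^+ 2 <= 4 * (al * (be * K2)) ->
  continuous B -> (forall j, continuous (u j)) ->
  (forall t, 0 < t -> is_derive t 1 B (al * \sum_j kap j * u j t)) ->
  (forall j t, 0 < t -> is_derive t 1 (u j)
     (- m * u j t - c * kap j * (\sum_i kap i * u i t) - be * kap j * B t)) ->
  decays e B /\ forall j, decays e (u j).
Proof.
move=> K2 K20 ed dm dA al0 disc cB cu dB du.
pose Z t := \sum_i kap i * u i t.
have cZ : continuous Z by apply: continuous_sum => i; have cui := cu i;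
  continuity.
have dZ (t : R) : 0 < t -> is_derive t 1 Z (-
  (m + c * K2) * Z t - be * K2 * B t).
  move=> t0; have -> : - (m + c * K2) * Z t - be * K2 * B t =
      \sum_i kap i * (- m * u i t - c * kap i * Z t - be * kap i * B t).
    transitivity (\sum_i (- m * (kap i * u i t) -
      (c * Z t + be * B t) * kap i ^+ 2)).
      by rewrite sumrB -!mulr_sumr -/(Z t) -/K2; ring.
    by apply: eq_bigr => i _; ring.
  by apply: is_derive_sum_seq => i; apply: is_derive_scale; exact: du.
have [Bd Zd] : decays e B /\ decays e Z.
  by apply: (decays_second_order _ al0 disc cB cZ dB dZ); lra.
split=> // j.
pose q t := u j t + (- (kap j / K2)) * Z t.
have qd : decays e q.
  apply: (@decays_first_order _ _ m).
  - lra.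
  - by have cuj := cu j; rewrite /q; continuity.
  - move=> t t0; have -> : - m * q t
    = (- m * u j t - c * kap j * Z t - be * kap j * B t)
        + (- (kap j / K2)) * (- (m + c * K2) * Z t - be * K2 * B t).
      by rewrite /q; field; rewrite gt_eqF.
    by apply: is_derive_add; [exact: du|apply: is_derive_scale; exact: dZ].
apply: eq_decays (decays_add qd (decays_scale (kap j / K2) Zd)) => t _.
by rewrite /q mulNr subrK.
Qed.

End LinearDecay.

(** * From decay of the coordinates to the maximal decay rate *)

Section EuclideanNorm.
Context {R : realType}.

Lemma decays_norm e (f : R -> R) : decays e f -> decays e (fun t => `|f t|).
Proof. by move=> [c cf]; exists c => t /cf; rewrite normr_id. Qed.

Lemma decays_sum e I (s : seq I) (F : I -> R -> R) :
  (forall i, decays e (F i)) -> decays e (fun t => \sum_(i <- s) F i t).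
Proof.
move=> dF; elim: s => [|i s IH].
  by exists 0 => t _; rewrite big_nil normr0 mul0r.
by apply: eq_decays (decays_add (dF i) IH) => t _; rewrite big_cons.
Qed.

(** The sum of squares of nonnegative numbers is at most the square of their sum. The induction
    carries the nonnegativity along, since the cross terms need it. *)
Lemma enorm_le m (z : 'rV[R[i]]_m) :
  enorm z <= \sum_j (`|complex.Re (z 0 j)| + `|complex.Im (z 0 j)|).
Proof.
rewrite /enorm.
suff [S0 H] : 0 <= \sum_j (`|complex.Re (z 0 j)| + `|complex.Im (z 0 j)|) /\
    \sum_j (complex.Re (z 0 j) ^+ 2 + complex.Im (z 0 j) ^+ 2) <=
    (\sum_j (`|complex.Re (z 0 j)| + `|complex.Im (z 0 j)|)) ^+ 2.
  by rewrite -[leRHS](ger0_norm S0) -sqrtr_sqr ler_wsqrtr.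
elim/big_ind2 : _ => [|a b a' b' [b0 ab] [b'0 ab']|j _].
- by rewrite expr0n.
- split; first exact: addr_ge0.
  by have := mulr_ge0 b0 b'0; nra.
- split; first exact: addr_ge0.
  rewrite -(real_normK (num_real (complex.Re _))) -(real_normK (num_real
    (complex.Im _))).
  by have := mulr_ge0 (normr_ge0 (complex.Re (z 0 j))) (normr_ge0 (complex.Im
    (z 0 j))); nra.
Qed.

Lemma decays_decay_rate m (y : R -> 'rV[R[i]]_m) (e : R) (f : R -> R) : 0 < e ->
  decays e f -> (forall t, 0 <= t -> enorm (y t) <= f t) -> decay_rate y e.
Proof.
move=> e0 [c cf] yf; split=> //; exists (`|c| + 1); first by rewrite ltr_wpDl.
move=> t t0; apply: le_trans (yf t t0) _; apply: le_trans (ler_norm _) _.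
apply: le_trans (cf t t0) _; rewrite ler_wpM2r ?expR_ge0//.
by rewrite (le_trans (ler_norm _))// lerDl.
Qed.

(** The maximal rate is a supremum, so rates strictly below d suffice. This margin absorbs the
    factor t at a double root. *)
Lemma le_max_decay_rate m (y : R -> 'rV[R[i]]_m) (d : R) : 0 < d ->
  (forall e, 0 < e -> e < d -> decay_rate y e) -> (d%:E <= max_decay_rate y)%E.
Proof.
move=> d0 H.
have le_max e : 0 < e -> e < d -> (e%:E <= max_decay_rate y)%E.
  by move=> e0 ed; apply: ereal_sup_ubound; exists e => //; exact: H.
have d2 : ((d / 2)%:E <= max_decay_rate y)%E by apply: le_max; lra.
case: (max_decay_rate y) le_max d2 => [s| |] le_max d2.
(* If the supremum s were below d, the midpoint of s and d would be a rate exceeding s; the bound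
   d/2 <= s keeps this midpoint positive. *)
- rewrite lee_fin leNgt; apply/negP => sd; rewrite lee_fin in d2.
  have : (s + d) / 2 <= s by rewrite -lee_fin; apply: le_max; lra.
  lra.
- by rewrite leey.
- by move: d2; rewrite leeNy_eq.
Qed.

End EuclideanNorm.

(** * The equations of the modes *)

Section TimeExtension.
Context {R : realType} {n : nat}.
Implicit Types (F : R -> 'rV[R]_n -> R) (w : 'rV[R]_n -> R).

(* Freezing a solution at its initial value for [t < 0] turns continuity up to
   [t = 0] into plain continuity. *)
Definition extend F (t : R) : 'rV[R]_n -> R := F (Num.max 0 t).

Lemma extend_ge0 F t : 0 <= t -> extend F t = F t.
Proof. by move=> t0; rewrite /extend max_r. Qed.

(** The extension is F composed with the continuous retraction (t, x) -> (max(0, t), x) onto the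
    half space where F is continuous. *)
Lemma extend_continuous F : continuous_up_to_0 F ->
  continuous (fun p : R * 'rV[R]_n => extend F p.1 p.2).
Proof.
move=> cF p; pose A := [set p : R * 'rV[R]_n | 0 <= p.1].
pose g (p : R * 'rV[R]_n) := (Num.max 0 p.1, p.2).
have gA q : A (g q) by rewrite /A /g/= le_max lexx.
have cg : continuous g.
  apply: continuous_pair; last by continuity.
  move=> q; apply: (@continuous_max _ _ (cst 0) fst q); first exact: cvg_cst.
  exact: cvg_fst.
have cA : F q.1 q.2 @[q --> within A (nbhs (g p))] --> F (g p).1 (g p).2.
  by rewrite (nbhs_subspace_in (gA p)); exact: cF.
have gw : g @ p --> within A (nbhs (g p)).
  move=> U nU.
  apply: (@filterS _ (nbhs p) _ (fun x => A (g x) -> U (g x)));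
    last exact: (cg p (fun y => A y -> U y) nU).
  by move=> x /(_ (gA x)).
exact: (cvg_comp _ _ gw cA).
Qed.

Lemma slice_continuous F t : continuous (fun p : R * 'rV[R]_n => F p.1 p.2) ->
  continuous (F t).
Proof.
move=> cF; apply: (continuous_compose (f := fun x => (t, x)) _ cF); continuity.
Qed.

Lemma jointly_continuous_slice F t : jointly_continuous F -> 0 < t ->
  continuous (F t).
Proof.
move=> cF t0 x; have ct : continuous (fun y : 'rV[R]_n => (t, y)) by continuity.
exact: (cvg_comp _ _ (ct x) (cF t x t0)).
Qed.

Lemma weighted_continuous F w : continuous_up_to_0 F -> continuous w ->
  continuous (fun t => cube_int (fun x => extend F t x * w x)).
Proof.
move=> /extend_continuous cF cw.
apply: (cube_int_continuous (F := fun t x => extend F t x * w x)).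
apply: continuous_mul => //.
by apply: (continuous_compose (f := snd)) => //; continuity.
Qed.

(** Near a time t > 0 the extension coincides with F, so differentiation under the integral sign
    applies with the time derivative of F. *)
Lemma weighted_derive F w (t : R) : continuous_up_to_0 F -> C1_time F ->
  continuous w ->
  0 < t ->
  is_derive t 1 (fun s => cube_int (fun x => extend F s x * w x))
    (cube_int (fun x => time_deriv F t x * w x)).
Proof.
move=> /extend_continuous cF [dF cdF] cw t0.
apply: (is_derive_cube_int (F := fun s x => extend F s x * w x)
  (G := fun s x => time_deriv F s x * w x)).
- by near=> s; have cs := slice_continuous (t := s) cF; continuity.
- near=> s => y; have s0 : 0 < s by near: s; exact: lt_nbhsr.
  have dE : is_derive (s : R) 1 (fun s : R => extend F s y) (time_deriv F s y).
    apply: (@near_eq_is_derive _ _ _ (fun s => F s y)).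
      near=> z; rewrite extend_ge0// ltW//; near: z; exact: lt_nbhsr.
    by rewrite /time_deriv derive1E; apply/derivableP/dF.
  have := is_derive_scale (w y) dE.
  by rewrite mulrC; under eq_fun do rewrite mulrC.
- have cw2 : continuous (fun p : R * 'rV[R]_n => w p.2).
    by apply: (continuous_compose (f := snd)) => //; continuity.
  by move=> y; apply: cvgM; [exact: cdF|exact: cw2].
Unshelve. all: end_near. Qed.

(** The difference quotients at x and at its translate are the same function of h, hence so are
    their limits. *)
Lemma partial_periodic j (f : 'rV[R]_n -> R) : Defs.periodic f ->
  Defs.periodic (partial j f).
Proof.
move=> pf x i; rewrite /partial /derive;
  apply: (congr1 (fun G : R -> R => lim (G @ 0^'))).
by apply/funext => h /=; rewrite addrA !pf.
Qed.

End TimeExtension.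

(** * The system tested against one wave *)

Section ModeEquations.
Context {R : realType} {n : nat}.
Variables (rho0 gamma mu lambda : R) (ks : seq 'rV[int]_n).
Variables (p q : 'rV[int]_n -> R).
Hypotheses (uks : uniq ks) (rho0_gt0 : 0 < rho0).
Hypotheses (pks : forall k, p k != 0 ->
  k \in ks) (pN : forall k, p (- k) = p k).
Hypotheses (qks : forall k, q k != 0 ->
  k \in ks) (qN : forall k, q (- k) = q k).
Variables (r : R -> 'rV[R]_n -> R) (v : R -> 'rV[R]_n -> 'rV[R]_n).
Hypothesis sol : error_solution rho0 gamma mu lambda
  (trig_kernel ks p) (trig_kernel ks q) r v.
Variable k : 'rV[int]_n.

Let vj j t := component (v t) j.
Let kap j : R := (k 0 j)%:~R.
Let K2 : R := \sum_j kap j ^+ 2.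
Let g : R := gamma * rho0 `^ (gamma - 1).

Section FixedTime.
Variables (t : R) (t0 : 0 < t).

Let rt_cont : continuous (r t).
Proof.
have cr := r_continuous sol.
by rewrite -(extend_ge0 r (ltW t0));
  apply: slice_continuous (extend_continuous cr).
Qed.

Let vt_cont j : continuous (vj j t).
Proof.
have cv : continuous_up_to_0 (vj j) := @v_continuous _ _ _ _ _ _ _ _ _ _ sol j.
by rewrite -(extend_ge0 (vj j) (ltW t0));
  apply: slice_continuous (extend_continuous cv).
Qed.

Let rt_per : Defs.periodic (r t) := r_periodic sol (ltW t0).

Let vt_per j : Defs.periodic (vj j t).
Proof. by move=> x i; rewrite /vj /component (v_periodic sol (ltW t0)). Qed.

Let rt_C1 j : C1_dir j (r t).
Proof.
have [dr cr] := r_C1_space sol j.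
by split=> [x|]; [exact: dr|exact: (jointly_continuous_slice cr)].
Qed.

Let vt_C1 i j : C1_dir i (vj j t).
Proof.
have [/(_ i) [dv cv] _] := v_C2_space sol j.
by split=> [x|]; [exact: dv|exact: (jointly_continuous_slice cv)].
Qed.

Let vt_C2 i l j : C1_dir i (partial l (vj j t)).
Proof.
have [_ /(_ l i) [dv cv]] := v_C2_space sol j.
by split=> [x|]; [exact: dv|exact: (jointly_continuous_slice cv)].
Qed.

Let pv_cont i j : continuous (partial i (vj j t)) := (vt_C1 i j).2.

Let div : 'rV[R]_n -> R := divergence (v t).

Let div_cont : continuous div.
Proof. by apply: continuous_sum => j; exact: pv_cont. Qed.

Let div_per : Defs.periodic div.
Proof.
by move=> x i; apply: eq_bigr => j _; exact: partial_periodic (@vt_per j) _ _.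
Qed.

(** Differentiating the finite sum termwise reduces the regularity of the divergence to the second
    derivatives of the velocity. *)
Let partial_div i : partial i div = fun x =>
  \sum_j partial i (partial j (vj j t)) x.
Proof.
apply/funext => x.
suff [_] : is_derive x (basis_vec i) div (\sum_j partial i (partial j
  (vj j t)) x) by [].
rewrite (_ : div = \sum_j partial j (vj j t)).
  by apply: is_derive_sum => j; apply: derivableP; exact: (vt_C2 i j j).1.
by apply/funext => y; rewrite fct_sumE.
Qed.

Let div_C1 i : C1_dir i div.
Proof.
split=> [x|]; last first.
  by rewrite partial_div; apply: continuous_sum => j; exact: (vt_C2 i j j).2.
rewrite (_ : div = \sum_j partial j (vj j t)).
  by apply: derivable_sum => j; exact: (vt_C2 i j j).1.
by apply/funext => y; rewrite fct_sumE.
Qed.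

(** [Zc] and [Zs] are the cosine and sine parts of the longitudinal component: k . a_k = Zc - i
    Zs. *)
Let Zc : R := \sum_j kap j * cos_coef (vj j t) k.
Let Zs : R := \sum_j kap j * sin_coef (vj j t) k.

Let cos_coef_div : cos_coef div k = 2 * pi * Zs.
Proof.
rewrite cos_coef_sum; last by move=> j; exact: pv_cont.
rewrite /Zs mulr_sumr; apply: eq_bigr => j _.
by rewrite (cos_coef_partial k (@vt_cont j) (@vt_per j) (vt_C1 j j)) mulrA.
Qed.

Let sin_coef_div : sin_coef div k = - (2 * pi * Zc).
Proof.
rewrite sin_coef_sum; last by move=> j; exact: pv_cont.
rewrite /Zc mulr_sumr -sumrN; apply: eq_bigr => j _.
by rewrite (sin_coef_partial k (@vt_cont j) (@vt_per j)
  (vt_C1 j j)) mulrA mulNr.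
Qed.

Let lapl_cont j : continuous (laplacian (vj j t)).
Proof. by apply: continuous_sum => i; exact: (vt_C2 i i j).2. Qed.

(** Two integrations by parts turn cosine into sine and back, each giving a factor 2 pi k_i; the
    sign comes from the second one. *)
Let cos_coef_lapl j :
  cos_coef (laplacian (vj j t)) k = - (4 * pi ^+ 2 * K2) * cos_coef (vj j t) k.
Proof.
rewrite cos_coef_sum => [|i]; last exact: (vt_C2 i i j).2.
rewrite /K2 mulr_sumr -sumrN mulr_suml; apply: eq_bigr => i _.
rewrite (cos_coef_partial k (@pv_cont i j) (partial_periodic i (@vt_per j))
  (vt_C2 i i j)).
by rewrite (sin_coef_partial k (@vt_cont j) (@vt_per j) (vt_C1 i j)) /kap; ring.
Qed.

Let sin_coef_lapl j :
  sin_coef (laplacian (vj j t)) k = - (4 * pi ^+ 2 * K2) * sin_coef (vj j t) k.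
Proof.
rewrite sin_coef_sum => [|i]; last exact: (vt_C2 i i j).2.
rewrite /K2 mulr_sumr -sumrN mulr_suml; apply: eq_bigr => i _.
rewrite (sin_coef_partial k (@pv_cont i j) (partial_periodic i (@vt_per j))
  (vt_C2 i i j)).
by rewrite (cos_coef_partial k (@vt_cont j) (@vt_per j) (vt_C1 i j)) /kap; ring.
Qed.

Let mass_rate : time_deriv r t =
  fun x => - rho0 * div x + - rho0 * Defs.conv (trig_kernel ks p) div x.
Proof.
by apply/funext => x; have := mass_eq sol x t0; rewrite -/div => ?; lra.
Qed.

Let conv_div_cont := conv_trig_kernel_continuous (ks := ks) (p := p) div_cont.

(** Real part of the equation for b_k, with b_k = [cos_coef] - i [sin_coef]; the factor i exchanges
    cosine and sine parts, and the convolution produces 1 + p k. *)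
Lemma cos_coef_mass :
  cos_coef (time_deriv r t) k = - (2 * pi * rho0 * (1 + p k)) * Zs.
Proof.
rewrite mass_rate (cos_coef_lin _ _ k div_cont conv_div_cont).
by rewrite (cos_coef_conv uks pks pN k div_cont) cos_coef_div; ring.
Qed.

Lemma sin_coef_mass :
  sin_coef (time_deriv r t) k = 2 * pi * rho0 * (1 + p k) * Zc.
Proof.
rewrite mass_rate (sin_coef_lin _ _ k div_cont conv_div_cont).
by rewrite (sin_coef_conv uks pks pN k div_cont) sin_coef_div; ring.
Qed.

(** The four terms are grouped as nested two-term combinations, with dummy factors 1, to match the
    linearity lemmas. *)
Let momentum_rate j : time_deriv (vj j) t = fun x =>
  1 * (mu / rho0 * laplacian (vj j t) x +
    (lambda + mu) / rho0 * partial j div x)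
  + 1 * (- (g / rho0) * partial j (r t) x
         + (- 1) * Defs.conv (trig_kernel ks q) (vj j t) x).
Proof.
apply/funext => x; apply: (mulfI (lt0r_neq0 rho0_gt0)).
by rewrite (momentum_eq sol x j t0) -/div -/g -/(vj j t); field; rewrite gt_eqF.
Qed.

Let pdiv_cont j : continuous (partial j div) := (div_C1 j).2.
Let pr_cont j : continuous (partial j (r t)) := (rt_C1 j).2.
Let conv_v_cont j := conv_trig_kernel_continuous (ks := ks) (p :=
  q) (@vt_cont j).

Lemma cos_coef_momentum j : cos_coef (time_deriv (vj j) t) k =
  - (c1 rho0 mu * K2 + q k) * cos_coef (vj j t) k
  - c2 rho0 mu lambda * kap j * Zc
  - 2 * pi * (g / rho0) * kap j * sin_coef (r t) k.
Proof.
have h1 := @lapl_cont j; have h2 := @pdiv_cont j; have h3 := @pr_cont j.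
have h4 := @conv_v_cont j.
rewrite momentum_rate cos_coef_lin; [|by continuity|by continuity].
rewrite !cos_coef_lin// cos_coef_lapl (cos_coef_conv uks qks qN k (@vt_cont j)).
rewrite (cos_coef_partial k div_cont div_per (div_C1 j)) sin_coef_div.
rewrite (cos_coef_partial k rt_cont rt_per (rt_C1 j)) /c1 /c2 /kap.
by field; rewrite gt_eqF.
Qed.

Lemma sin_coef_momentum j : sin_coef (time_deriv (vj j) t) k =
  - (c1 rho0 mu * K2 + q k) * sin_coef (vj j t) k
  - c2 rho0 mu lambda * kap j * Zs
  + 2 * pi * (g / rho0) * kap j * cos_coef (r t) k.
Proof.
have h1 := @lapl_cont j; have h2 := @pdiv_cont j; have h3 := @pr_cont j.
have h4 := @conv_v_cont j.
rewrite momentum_rate sin_coef_lin; [|by continuity|by continuity].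
rewrite !sin_coef_lin// sin_coef_lapl (sin_coef_conv uks qks qN k (@vt_cont j)).
rewrite (sin_coef_partial k div_cont div_per (div_C1 j)) cos_coef_div.
rewrite (sin_coef_partial k rt_cont rt_per (rt_C1 j)) /c1 /c2 /kap.
by field; rewrite gt_eqF.
Qed.

End FixedTime.

Let vj_cont0 j : continuous_up_to_0 (vj j) :=
  @v_continuous _ _ _ _ _ _ _ _ _ _ sol j.
Let r_cont0 : continuous_up_to_0 r := r_continuous sol.
Let vj_C1 j : C1_time (vj j) := v_C1_time sol j.
Let coswk := @cosw_continuous R n k.
Let sinwk := @sinw_continuous R n k.

Let cr t := cos_coef (extend r t) k.
Let sr t := sin_coef (extend r t) k.
Let cv j t := cos_coef (extend (vj j) t) k.
Let sv j t := sin_coef (extend (vj j) t) k.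

Let cr_cont : continuous cr := weighted_continuous r_cont0 coswk.
Let sr_cont : continuous sr := weighted_continuous r_cont0 sinwk.
Let cv_cont j : continuous (cv j) := weighted_continuous (@vj_cont0 j) coswk.
Let sv_cont j : continuous (sv j) := weighted_continuous (@vj_cont0 j) sinwk.

(** [al] and [be] are the coupling constants of mass and momentum; their product is c5 (1 + p k),
    the stiffness of the oscillator divided by |k|^2. *)
Let al := 2 * pi * rho0 * (1 + p k).
Let be := 2 * pi * (g / rho0).
Let m := c1 rho0 mu * K2 + q k.
Let c := c2 rho0 mu lambda.

Let sr_rate (t : R) : 0 < t -> is_derive t 1 sr (al * \sum_j kap j * cv j t).
Proof.
move=> t0; have := weighted_derive r_cont0 (r_C1_time sol) sinwk t0.
rewrite -/(sin_coef _ k) sin_coef_mass// /cv.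
by under [in X in _ -> X]eq_bigr do rewrite extend_ge0 ?(ltW t0)//.
Qed.

Let cr_rate (t : R) : 0 < t ->
  is_derive t 1 cr (- (al * \sum_j kap j * sv j t)).
Proof.
move=> t0; have := weighted_derive r_cont0 (r_C1_time sol) coswk t0.
rewrite -/(cos_coef _ k) cos_coef_mass// /sv mulNr.
by under [in X in _ -> X]eq_bigr do rewrite extend_ge0 ?(ltW t0)//.
Qed.

Let cv_rate j (t : R) : 0 < t -> is_derive t 1 (cv j)
  (- m * cv j t - c * kap j * (\sum_i kap i * cv i t) - be * kap j * sr t).
Proof.
move=> t0; have := weighted_derive (@vj_cont0 j) (vj_C1 j) coswk t0.
rewrite -/(cos_coef _ k) cos_coef_momentum// /cv /sr !extend_ge0 ?(ltW t0)//.
by under [in X in _ -> X]eq_bigr do rewrite extend_ge0 ?(ltW t0)//.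
Qed.

Let sv_rate j (t : R) : 0 < t -> is_derive t 1 (sv j)
  (- m * sv j t - c * kap j * (\sum_i kap i * sv i t) + be * kap j * cr t).
Proof.
move=> t0; have := weighted_derive (@vj_cont0 j) (vj_C1 j) sinwk t0.
rewrite -/(sin_coef _ k) sin_coef_momentum// /sv /cr !extend_ge0 ?(ltW t0)//.
by under [in X in _ -> X]eq_bigr do rewrite extend_ge0 ?(ltW t0)//.
Qed.

(** The real system splits into two independent copies of the system of [decays_mode]: one for
    ([sr], [cv]) and one for (- [cr], [sv]). *)
Lemma mode_decays (e d : R) :
  0 < K2 -> e < d -> d <= m -> 2 * d <= m + c * K2 -> 0 <= p k ->
  (m + c * K2) ^+ 2 <= 4 * (al * (be * K2)) ->
  [/\ decays e cr, decays e sr, forall j, decays e (cv j) & forall j,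
    decays e (sv j)].
Proof.
move=> K20 ed dm dA p0 disc.
have al0 : 0 < al.
  by rewrite /al !mulr_gt0 ?pi_gt0// ltr_pwDl.
have [Bs uc] := @decays_mode R n e d kap sr cv m c al be K20 ed dm dA al0 disc
  sr_cont cv_cont sr_rate cv_rate.
(* The sign change gives the second pair exactly the equations of the first. *)
pose ncr t := -1 * cr t.
have ncr_cont : continuous ncr by rewrite /ncr; continuity.
have ncr_rate (t : R) : 0 < t -> is_derive t 1 ncr (al * \sum_j kap j * sv j t).
  by move=> t0; rewrite -[al * _]opprK -mulN1r; apply: is_derive_scale;
    exact: cr_rate.
have sv_rate' j (t : R) : 0 < t -> is_derive t 1 (sv j)
  (- m * sv j t - c * kap j * (\sum_i kap i * sv i t) - be * kap j * ncr t).
  by move=> t0; rewrite /ncr mulN1r mulrN opprK; exact: sv_rate.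
have [Bc us] := @decays_mode R n e d kap ncr sv m c al be K20 ed dm dA al0 disc
  ncr_cont sv_cont ncr_rate sv_rate'.
split=> //; apply: eq_decays (decays_scale (-1) Bc) => t _.
by rewrite /ncr mulrA mulrNN !mul1r.
Qed.

(** For k = 0 all coupling vanishes: the density coefficient is its mean, which is 0, and each
    velocity coefficient is damped at rate [q 0] alone. *)
Lemma zero_mode_decays (e d : R) : k = 0 -> zero_mean r -> e < d -> d <= q k ->
  [/\ decays e cr, decays e sr, forall j, decays e (cv j) & forall j,
    decays e (sv j)].
Proof.
move=> k0 r0 ed dq.
have kap0 j : kap j = 0 by rewrite /kap k0 mxE.
have mE : m = q k by rewrite /m /K2 big1 ?mulr0 ?add0r// => j _;
  rewrite kap0 expr0n.
have decays0 : decays e (fun=> 0).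
  by exists 0 => t _; rewrite normr0 mul0r.
split.
- apply: eq_decays decays0 => t t0; rewrite /cr extend_ge0// -(r0 t t0).
  by apply: eq_cube_int => x; rewrite k0 /cosw wave_dot0l mulr0 cos0 mulr1.
- apply: eq_decays decays0 => t t0; rewrite /sr -[LHS](@cube_int_cst R n).
  by apply: eq_cube_int => x; rewrite k0 /sinw wave_dot0l mulr0 sin0 mulr0.
- move=> j; apply: (@decays_first_order _ _ _ m) => [|//|t t0];
  first by rewrite mE; lra.
  by have := cv_rate j t0; rewrite kap0 !mulr0 !mul0r !subr0.
- move=> j; apply: (@decays_first_order _ _ _ m) => [|//|t t0];
  first by rewrite mE; lra.
  by have := sv_rate j t0; rewrite kap0 !mulr0 !mul0r subr0 addr0.
Qed.

Lemma fourier_coef_r t : 0 <= t ->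
  fourier_coef (r t) k = Complex (cr t) (- sr t).
Proof.
move=> t0; rewrite /cr /sr extend_ge0//; apply: fourier_coefE.
by rewrite -(extend_ge0 r t0);
  apply: slice_continuous (extend_continuous r_cont0).
Qed.

Lemma fourier_coef_v j t : 0 <= t ->
  fourier_coef (component (v t) j) k = Complex (cv j t) (- sv j t).
Proof.
move=> t0; rewrite /cv /sv extend_ge0//; apply: fourier_coefE.
by rewrite -/(vj j t) -(extend_ge0 (vj j) t0);
  apply: slice_continuous (extend_continuous (@vj_cont0 j)).
Qed.

Lemma enorm_decays e :
  [/\ decays e cr, decays e sr, forall j, decays e (cv j) & forall j,
    decays e (sv j)] ->
  0 < e -> decay_rate (mode r v k) e.
Proof.
move=> [dcr dsr dcv dsv] e0.
pose f t := (`|cr t| + `|sr t|) + \sum_j (`|cv j t| + `|sv j t|).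
apply: (@decays_decay_rate _ _ _ _ f) => //.
  apply: decays_add; first by apply: decays_add; exact: decays_norm.
  by apply: decays_sum => j; apply: decays_add; exact: decays_norm.
move=> t t0; apply: le_trans (enorm_le _) _; rewrite big_split_ord/= big_ord1.
rewrite /mode row_mxEl mxE fourier_coef_r//= normrN /f lerD2l.
by apply: ler_sum => j _; rewrite row_mxEr mxE fourier_coef_v//= normrN.
Qed.

End ModeEquations.

(** * The explicit coefficients *)

Section WaveVectors.
Context {R : realType} {n : nat}.
Implicit Types k l : 'rV[int]_n.

Lemma wave_sqnorm_gt0 k : k != 0 -> 0 < wave_sqnorm k :> R.
Proof.
move=> k0; rewrite lt_neqAle sumr_ge0 ?andbT => [|j _]; last exact: sqr_ge0.
apply: contra k0; rewrite eq_sym psumr_eq0 => [/allP H|j _];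
  last exact: sqr_ge0.
apply/eqP/rowP => j; rewrite mxE; apply/eqP.
by have := H j (mem_index_enum j); rewrite sqrf_eq0 intr_eq0.
Qed.

Lemma wave_norm_eq0 k : (wave_norm k == 0 :> R) = (k == 0).
Proof.
apply/idP/eqP => [|->].
  by apply: contraTeq => /wave_sqnorm_gt0 ?; rewrite gt_eqF// sqrtr_gt0.
rewrite /wave_norm /wave_sqnorm big1 ?sqrtr0// => j _.
by rewrite mxE expr0n.
Qed.

Lemma wave_sqnormE k : wave_sqnorm k = wave_norm k ^+ 2 :> R.
Proof. by rewrite sqr_sqrtr// sumr_ge0// => j _; exact: sqr_ge0. Qed.

Lemma wave_normN k : wave_norm (- k) = wave_norm k :> R.
Proof.
congr Num.sqrt; apply: eq_bigr => j _.
by rewrite mxE intrN sqrrN.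
Qed.

(** The integer points with coordinates between -M and M, encoded by functions into 2 M + 1 values
    shifted by M; this finite list indexes the kernels. *)
Definition wave_box (M : nat) : seq 'rV[int]_n :=
  [seq \row_j ((f j : nat)%:Z - M%:Z) | f : {ffun 'I_n -> 'I_(M + M).+1}].

Lemma wave_box_uniq M : uniq (wave_box M).
Proof.
rewrite map_inj_uniq ?enum_uniq// => f h /rowP fh; apply/ffunP => j.
by have := fh j; rewrite !mxE => /addIr [] /val_inj.
Qed.

(** Each |k_j| is at most |k|, so the Euclidean ball of radius M lies in the box. *)
Lemma mem_wave_box M k : (wave_norm k <= M%:R :> R) -> k \in wave_box M.
Proof.
move=> kM.
have kjM (j : 'I_n) : (`|(k 0 j)%R| <= M)%N.
  rewrite -(ler_nat R); apply: le_trans kM.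
  rewrite natr_absz intr_norm -sqrtr_sqr ler_wsqrtr//.
  rewrite /wave_sqnorm (bigD1 j)//= lerDl sumr_ge0// => i _; exact: sqr_ge0.
have H (j : 'I_n) : (absz (k 0 j + M%:Z)%R < (M + M).+1)%N.
  by have := kjM j; lia.
apply/mapP; exists [ffun j => Ordinal (H j)]; first by rewrite mem_enum.
by apply/rowP => j; rewrite mxE ffunE/=; have := kjM j; lia.
Qed.

End WaveVectors.

(** * Symmetry, support and damping bounds of the prescribed coefficients *)

Section ExplicitCoefficients.
Context {R : realType} {n : nat}.
Variables (rho0 gamma mu lambda d K : R).
Implicit Types k l : 'rV[int]_n.
Notation cu := (@phi_u_coef R n rho0 mu lambda d K).
Notation cr := (@phi_rho_coef R n rho0 gamma mu lambda d K).

(** The test k = 0, the cutoff and the values all depend on k through its norm. Both the evenness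
    and the isotropy of the kernel follow. *)
Lemma phi_u_coef_radial k l : wave_norm k = wave_norm l :> R -> cu k = cu l.
Proof.
by move=> kl; rewrite /phi_u_coef -!(wave_norm_eq0 (R := R)) !wave_sqnormE kl.
Qed.

Lemma phi_rho_coef_radial k l : wave_norm k = wave_norm l :> R -> cr k = cr l.
Proof.
move=> kl; rewrite /phi_rho_coef (phi_u_coef_radial kl).
by rewrite -!(wave_norm_eq0 (R := R)) !wave_sqnormE kl.
Qed.

(** The zero mode, where the coefficient is d, satisfies the bound because K is positive. *)
Lemma phi_u_coef_support k : 0 < K -> cu k != 0 -> wave_norm k <= K.
Proof.
move=> K0; have [-> _|k0] := eqVneq k 0.
  have /eqP -> : wave_norm (0 : 'rV[int]_n) == 0 :> R by rewrite wave_norm_eq0.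
  exact: ltW.
by rewrite /phi_u_coef (negbTE k0); case: ifP; rewrite ?eqxx.
Qed.

Lemma phi_rho_coef_support k : cr k != 0 -> wave_norm k <= K.
Proof.
rewrite /phi_rho_coef; have [_|_] := eqVneq k 0; first by rewrite eqxx.
by case: ifP; rewrite ?eqxx.
Qed.

Hypotheses (rho0_gt0 : 0 < rho0) (gamma_gt0 : 0 < gamma).
Variable k : 'rV[int]_n.
Hypotheses (k0 : k != 0) (kK : wave_norm k <= K).
Notation K2 := (wave_sqnorm k : R).

(** The last two entries of the maximum are exactly what makes the transverse damping at least d and
    the longitudinal damping at least 2 d. *)
Lemma phi_u_coef_bounds :
  d <= c1 rho0 mu * K2 + cu k /\
  2 * d <= c1 rho0 mu * K2 + cu k + c2 rho0 mu lambda * K2.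
Proof.
rewrite /phi_u_coef (negbTE k0) kK; set M := Num.max 0 _.
have M1 : d - c1 rho0 mu * K2 <= M by rewrite !le_max lexx !orbT.
have M2 : 2 * d - (c1 rho0 mu + c2 rho0 mu lambda) * K2 <= M.
  by rewrite !le_max lexx !orbT.
by split; lra.
Qed.

Lemma phi_rho_coef_ge0 : 0 <= cr k.
Proof. by rewrite /phi_rho_coef (negbTE k0) kK le_max lexx. Qed.

(** The second entry of the maximum defining the coefficient, rearranged: the discriminant of s^2 +
    A s + c5 |k|^2 (1 + phi_rho) is nonpositive. *)
Lemma phi_rho_coef_discriminant :
  (c1 rho0 mu * K2 + cu k + c2 rho0 mu lambda * K2) ^+ 2 <=
  4 * c5 rho0 gamma * K2 * (1 + cr k).
Proof.
have K20 : 0 < K2 := wave_sqnorm_gt0 k0.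
have c50 : 0 < c5 rho0 gamma.
  by rewrite /c5 !mulr_gt0 ?exprn_gt0 ?pi_gt0 ?powR_gt0.
have -> : c1 rho0 mu * K2 + cu k + c2 rho0 mu lambda * K2 =
    (c1 rho0 mu + c2 rho0 mu lambda) * K2 + cu k by ring.
have c5K : 0 < 4 * c5 rho0 gamma * K2 by do 2![apply: mulr_gt0 => //].
rewrite [leRHS]mulrC -ler_pdivrMr// -lerBlDl.
by rewrite /phi_rho_coef (negbTE k0) kK le_max lexx orbT.
Qed.

End ExplicitCoefficients.

(** * Admissibility of the kernels and the decay bound *)

Lemma isotropic_trig_kernel (R : realType) n (ks : seq 'rV[int]_n)
  (p : 'rV[int]_n -> R) :
  uniq ks -> (forall k, p k != 0 -> k \in ks) -> (forall k, p (- k) = p k) ->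
  (forall k l, wave_norm k = wave_norm l :> R -> p k = p l) ->
  conv_kernel (trig_kernel ks p).
Proof.
move=> uks pks pN pr; split.
- exact: trig_kernel_continuous.
- exact: trig_kernel_periodic.
- by move=> k l kl; rewrite !fourier_coef_trig_kernel// (pr k l kl).
Qed.

Unset Implicit Arguments.

Theorem theorem3p6 (R : realType) (n : nat) (hn : (1 <= n)%N)
    (rho0 gamma mu lambda : R)
    (hrho0 : 0 < rho0) (hgamma : 0 < gamma) (hmu : 0 < mu)
    (hlambda : 0 <= lambda + 2 * mu / 3)
    (d K : R) (hd : 0 < d) (hK : 0 < K) :
  exists phi_rho phi_u : 'rV[R]_n -> R,
    [/\ conv_kernel phi_rho,
        conv_kernel phi_u,
        forall k : 'rV[int]_n,
          fourier_coef phi_u k = (phi_u_coef rho0 mu lambda d K k)%:C%C,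
        forall k : 'rV[int]_n,
          fourier_coef phi_rho k =
            (phi_rho_coef rho0 gamma mu lambda d K k)%:C%C &
        forall (r : R -> 'rV[R]_n -> R) (v : R -> 'rV[R]_n -> 'rV[R]_n),
          error_solution rho0 gamma mu lambda phi_rho phi_u r v ->
          zero_mean r ->
          forall k : 'rV[int]_n, wave_norm k <= K ->
            (d%:E <= max_decay_rate (mode r v k))%E].
Proof.
(* A natural number above K, so that the box contains every wave vector where a coefficient is
   nonzero. *)
have [M KM] : exists M : nat, K <= M%:R.
  by exists (Num.truncn K).+1; rewrite ltW// truncnS_gt.
pose ks := @wave_box n M; have uks : uniq ks := wave_box_uniq M.
pose pu := @phi_u_coef R n rho0 mu lambda d K.
pose pr := @phi_rho_coef R n rho0 gamma mu lambda d K.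
have pu_ks k : pu k != 0 -> k \in ks.
  by move=> /(phi_u_coef_support hK) kK; apply: mem_wave_box (le_trans kK KM).
have pr_ks k : pr k != 0 -> k \in ks.
  by move=> /phi_rho_coef_support kK; apply: mem_wave_box (le_trans kK KM).
have puN k : pu (- k) = pu k := phi_u_coef_radial _ _ _ _ _ (wave_normN k).
have prN k : pr (- k) = pr k := phi_rho_coef_radial _ _ _ _ _ _ (wave_normN k).
exists (trig_kernel ks pr), (trig_kernel ks pu); split.
- by apply: isotropic_trig_kernel => // k l; exact: phi_rho_coef_radial.
- by apply: isotropic_trig_kernel => // k l; exact: phi_u_coef_radial.
- exact: fourier_coef_trig_kernel.
- exact: fourier_coef_trig_kernel.
(* It suffices that every positive e < d is a decay rate of the mode. *)
move=> r v sol r0 k kK; apply: le_max_decay_rate => // e e0 ed.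
apply: (enorm_decays sol) => //.
have [k0|k0] := eqVneq k 0.
  apply: (zero_mode_decays uks hrho0 pu_ks puN sol k0 r0 ed).
  by rewrite /pu /phi_u_coef k0 eqxx.
have [dm dA] := phi_u_coef_bounds rho0 mu lambda d k0 kK.
apply: (mode_decays uks hrho0 pr_ks prN pu_ks puN sol _ ed dm dA).
- exact: wave_sqnorm_gt0.
- exact: phi_rho_coef_ge0.
- apply: le_trans (phi_rho_coef_discriminant mu lambda d hrho0 hgamma k0 kK) _.
  (* The two sides are equal: c5 (1 + phi_rho) is the product of the coupling constants of mass and
     momentum, where rho0 cancels. *)
  rewrite le_eqVlt; apply/orP; left; apply/eqP; rewrite /c5 -/(pr k).
  rewrite -/(wave_sqnorm k).
  by field; rewrite gt_eqF.
Qed.
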